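(* Let $M^3$ be a smooth closed orientable $3$-manifold, let $f:M^3\to M^3$ be an $A$-diffeomorphism, and let $\mathcal{B}$ be a two-dimensional surface basic set of $f$. If $\mathcal{B}$ is an attractor, then $\mathcal{B}$ has type $(2,1)$; if $\mathcal{B}$ is a repeller, then $\mathcal{B}$ has type $(1,2)$.
   Context: A point $x$ is non-wandering for a diffeomorphism $f:M\to M$ of a closed manifold if for every neighborhood $U$ of $x$ one has $f^n(U)\cap U\neq\emptyset$ for infinitely many integers $n$; $NW(f)$ is the set of non-wandering points. A closed $f$-invariant set $\Lambda\subset M$ is hyperbolic if there is a continuous $df$-invariant splitting $T_\Lambda M=E^s_\Lambda\oplus E^u_\Lambda$ and constants $C>0$, $\lambda<1$ with $\|df^n(v)\|\le C\lambda^n\|v\|$ and $\|df^{-n}(w)\|\le C\lambda^n\|w\|$ for all $v\in E^s_\Lambda$, $w\in E^u_\Lambda$, $n\in\mathbb{N}$. An $A$-diffeomorphism is a diffeomorphism $f$ such that $NW(f)$ is hyperbolic and the periodic points of $f$ are dense in $NW(f)$. By Smale's Spectral Decomposition Theorem, $NW(f)$ is then a finite disjoint union of basic sets $\Omega_1,\dots,\Omega_m$, each closed, $f$-invariant and containing a dense orbit. The type of a basic set $\Omega$ is the pair $(a,b)$ with $a=\dim E^s_x$, $b=\dim E^u_x$, $x\in\Omega$. A basic set $\mathcal{B}$ is an attractor of $f$ if there is a closed neighborhood $U$ of $\mathcal{B}$ with $f(U)\subset \mathrm{int}\,U$ and $\bigcap_{j\ge0}f^j(U)=\mathcal{B}$;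 it is a repeller of $f$ if it is an attractor of $f^{-1}$. A basic set $\mathcal{B}$ of an $A$-diffeomorphism $f:M^3\to M^3$ is called a surface basic set if $\mathcal{B}$ is contained in an $f$-invariant closed surface (not necessarily connected) topologically embedded in $M^3$. ''Two-dimensional'' means of topological dimension $2$. *)

(* Defs.v *)
From mathcomp Require Import all_boot all_order all_algebra.
From mathcomp Require Import all_classical all_reals all_analysis.

Set Implicit Arguments.
Unset Strict Implicit.
Unset Printing Implicit Defensive.

Import Order.TTheory GRing.Theory Num.Theory.
Import numFieldNormedType.Exports.

Local Open Scope classical_set_scope.
Local Open Scope ring_scope.

(* Meant for open U: all limits and differentials are taken in the whole
   space. C^(k+1) asks that x |-> df_x(v) be C^k for each fixed v, which in
   finite dimension is the usual notion. *)
Fixpoint Ck_on (R : realType) (V W : normedModType R) (k : nat) (U : set V)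
    (f : V -> W) : Prop :=
  match k with
  | 0 => {in U, continuous f}
  | k'.+1 => {in U, forall x, differentiable f x} /\
             forall v : V, Ck_on k' U (fun x => 'd f x v)
  end.

Definition smooth_on (R : realType) (V W : normedModType R) (U : set V)
    (f : V -> W) : Prop := forall k, Ck_on k U f.

(* Homeomorphisms between an open set of M and an open set of R^n; only the
   values of chart_fun on chart_dom, and of chart_inv on the image of
   chart_dom, are meaningful. *)
Record chart (R : realType) (n : nat) (M : topologicalType) := Chart {
  chart_dom : set M ;
  chart_fun :> M -> 'rV[R]_n ;
  chart_inv : 'rV[R]_n -> M ;
  chart_dom_open : open chart_dom ;
  chart_img_open : open (chart_fun @` chart_dom) ;
  chartK : {in chart_dom, cancel chart_fun chart_inv} ;
  chart_continuous : {in chart_dom, continuous chart_fun} ;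
  chart_inv_continuous : {in chart_fun @` chart_dom, continuous chart_inv} }.

(* Hausdorff, compact, locally Euclidean without boundary; second countability
   follows from compactness. *)
Definition closed_topological_manifold (R : realType) (n : nat)
    (N : topologicalType) : Prop :=
  [/\ hausdorff_space N, compact [set: N] &
      forall x : N, exists c : chart R n N, chart_dom c x].

Section ChangeOfChart.
Variables (R : realType) (n : nat) (M : topologicalType).
Implicit Types c d : chart R n M.

Definition smooth_transition c d : Prop :=
  smooth_on (c @` (chart_dom c `&` chart_dom d)) (d \o chart_inv c).

(* Tangent vectors are row vectors: v has coordinates v in the chart c at y
   iff it has coordinates v *m chart_jac c d y in the chart d. *)
Definition chart_jac c d (y : M) : 'M[R]_n := 'J (d \o chart_inv c) (c y).

End ChangeOfChart.

(* A C^infinity structure, given by an atlas (chart_at x)_x indexed by the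
   points of M; any atlas contains one of this form, which generates the same
   structure. *)
Record smooth_structure (R : realType) (n : nat) (M : topologicalType) :=
  SmoothStructure {
    chart_at :> M -> chart R n M ;
    chart_at_dom : forall x, chart_dom (chart_at x) x ;
    chart_at_smooth : forall x y, smooth_transition (chart_at x) (chart_at y) }.

Section Manifold.
Variables (R : realType) (n : nat) (M : topologicalType).
Variable S : smooth_structure R n M.

(* There is an atlas O of the smooth structure S whose coordinate changes all
   preserve orientation. *)
Definition orientable : Prop :=
  exists O : M -> chart R n M,
    [/\ forall x, chart_dom (O x) x,
        forall x y, smooth_transition (O x) (S y) /\
                    smooth_transition (S y) (O x) &
        forall x y z, chart_dom (O x) z -> chart_dom (O y) z ->
          0 < \det (chart_jac (O x) (O y) z)].

Definition Ck_map (k : nat) (f : M -> M) : Prop :=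
  continuous f /\
  forall x y, Ck_on k (S x @` (chart_dom (S x) `&` f @^-1` chart_dom (S y)))
                    (S y \o f \o chart_inv (S x)).

(* C^1 is the weakest regularity under which hyperbolicity makes sense. *)
Record diffeomorphism := Diffeomorphism {
  diffeo_fun :> M -> M ;
  diffeo_inv : M -> M ;
  diffeoK : cancel diffeo_fun diffeo_inv ;
  diffeoVK : cancel diffeo_inv diffeo_fun ;
  diffeo_C1 : Ck_map 1 diffeo_fun ;
  diffeo_inv_C1 : Ck_map 1 diffeo_inv }.

Definition inverse_diffeo (f : diffeomorphism) : diffeomorphism :=
  Diffeomorphism (diffeoVK f) (diffeoK f) (diffeo_inv_C1 f) (diffeo_C1 f).

(* T_xM is 'rV[R]_n, through the coordinates of the chart S x. Then
   df_x : T_xM -> T_{f x}M is v |-> v *m tangent_map f x. *)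
Definition tangent_map (f : M -> M) (x : M) : 'M[R]_n :=
  'J (S (f x) \o f \o chart_inv (S x)) (S x x).

(* g x is the Gram matrix of the inner product of T_xM; smoothness is that of
   the Gram matrices in the coordinates of any fixed chart S x. *)
Definition riemannian_metric (g : M -> 'M[R]_n) : Prop :=
  [/\ forall x, (g x)^T = g x,
      forall x (v : 'rV[R]_n), v != 0 -> 0 < (v *m g x *m v^T) 0 0 &
      forall x, smooth_on (S x @` chart_dom (S x))
        ((fun y => chart_jac (S x) (S y) y *m g y *m
                   (chart_jac (S x) (S y) y)^T) \o chart_inv (S x))].

Definition tangent_norm (g : M -> 'M[R]_n) (x : M) (v : 'rV[R]_n) : R :=
  Num.sqrt ((v *m g x *m v^T) 0 0).

(* The subspace E x of T_xM is the row space of a matrix. The field of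
   subspaces is continuous if near each point of L, in the coordinates of some
   chart, it has a continuous frame, given by the rows of A y. *)
Definition continuous_subbundle (L : set M) (E : M -> 'M[R]_n) : Prop :=
  forall x, L x -> exists V : set M, exists k : nat, exists A : M -> 'M[R]_(k, n),
    [/\ open V, V x, V `<=` chart_dom (S x),
        {within V `&` L, continuous A} &
        forall y, (V `&` L) y ->
          row_free (A y) /\ (A y == E y *m chart_jac (S y) (S x) y)%MS].

Definition hyperbolic_splitting (f : diffeomorphism) (L : set M)
    (Es Eu : M -> 'M[R]_n) : Prop :=
  [/\ continuous_subbundle L Es /\ continuous_subbundle L Eu,
      forall x, L x ->
        (Es x + Eu x == 1%:M)%MS /\ (Es x :&: Eu x == (0 : 'M[R]_n))%MS,
      forall x, L x -> (Es x *m tangent_map f x == Es (f x))%MS /\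
                       (Eu x *m tangent_map f x == Eu (f x))%MS &
      exists g, riemannian_metric g /\ exists C lam : R,
        [/\ 0 < C, lam < 1,
            forall x (v : 'rV[R]_n) (k : nat), L x -> (v <= Es x)%MS ->
              tangent_norm g (iter k f x) (v *m tangent_map (iter k f) x)
                <= C * lam ^+ k * tangent_norm g x v &
            forall x (w : 'rV[R]_n) (k : nat), L x -> (w <= Eu x)%MS ->
              tangent_norm g (iter k (diffeo_inv f) x)
                  (w *m tangent_map (iter k (diffeo_inv f)) x)
                <= C * lam ^+ k * tangent_norm g x w]].

Definition invariant_set (f : M -> M) (L : set M) : Prop := f @` L = L.

Definition hyperbolic (f : diffeomorphism) (L : set M) : Prop :=
  [/\ closed L, invariant_set f L & exists Es Eu, hyperbolic_splitting f L Es Eu].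

Definition iterz (f : diffeomorphism) (k : int) : M -> M :=
  match k with
  | Posz m => iter m f
  | Negz m => iter m.+1 (diffeo_inv f)
  end.

Definition nonwandering (f : diffeomorphism) : set M :=
  [set x | forall U, nbhs x U ->
     infinite_set [set k : int | (iterz f k @` U) `&` U !=set0]].

Definition periodic_points (f : diffeomorphism) : set M :=
  [set x | exists2 k : nat, (0 < k)%N & iter k f x = x].

Definition A_diffeomorphism (f : diffeomorphism) : Prop :=
  hyperbolic f (nonwandering f) /\
  nonwandering f `<=` closure (periodic_points f).

Definition has_dense_orbit (f : diffeomorphism) (L : set M) : Prop :=
  exists2 x, L x & L `<=` closure (range (fun k : int => iterz f k x)).

(* One of the pieces of the spectral decomposition of NW(f); that decomposition
   is unique, each piece being the closure of an orbit. *)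
Definition basic_set (f : diffeomorphism) (B : set M) : Prop :=
  exists m : nat, exists Omega : 'I_m -> set M,
    [/\ forall i, [/\ closed (Omega i), invariant_set f (Omega i) &
                      has_dense_orbit f (Omega i)],
        trivIset setT Omega,
        \bigcup_i Omega i = nonwandering f &
        exists i, Omega i = B].

(* The splitting is that of NW(f), which hyperbolicity determines uniquely. *)
Definition basic_set_type (f : diffeomorphism) (B : set M) (a b : nat) : Prop :=
  exists Es Eu, hyperbolic_splitting f (nonwandering f) Es Eu /\
    forall x, B x -> \rank (Es x) = a /\ \rank (Eu x) = b.

Definition attractor (f : diffeomorphism) (B : set M) : Prop :=
  exists U : set M,
    [/\ closed U, B `<=` U°, f @` U `<=` U° &
        \bigcap_j (iter j f @` U) = B].

Definition repeller (f : diffeomorphism) (B : set M) : Prop :=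
  attractor (inverse_diffeo f) B.

Definition topological_embedding (N : topologicalType) (e : N -> M) : Prop :=
  [/\ injective e, continuous e &
      forall U, open U -> exists2 V, open V & e @^-1` V = U].

Definition embedded_closed_surface (F : set M) : Prop :=
  exists N : topologicalType, exists e : N -> M,
    [/\ closed_topological_manifold R 2 N, topological_embedding e &
        range e = F].

Definition surface_basic_set (f : diffeomorphism) (B : set M) : Prop :=
  basic_set f B /\
  exists F, [/\ embedded_closed_surface F, invariant_set f F & B `<=` F].

End Manifold.

(* Lebesgue covering dimension of the subspace B, whose relatively open sets
   are written as traces on B of open sets of the ambient space T. *)
Definition covering_dim_le (T : topologicalType) (B : set T) (d : nat) : Prop :=
  forall (m : nat) (U : 'I_m -> set T),
    (forall i, open (U i)) -> B `<=` \bigcup_i U i ->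
    exists p : nat, exists V : 'I_p -> set T,
      [/\ forall j, open (V j), B `<=` \bigcup_j V j,
          forall j, exists i, V j `&` B `<=` U i &
          forall J : {set 'I_p}, (d.+1 < #|J|)%N ->
            B `&` \bigcap_(j in [set` J]) V j = set0].

Definition topological_dim (T : topologicalType) (B : set T) (d : nat) : Prop :=
  covering_dim_le B d /\ forall k, (k < d)%N -> ~ covering_dim_le B k.

(* Main.v *)
(* The ranks of E^s and E^u are constant on B because B contains a dense orbit;
   we show that E^u cannot have rank 3, nor rank 2 when B is an attractor, and
   apply this to f and to its inverse. Fix h = f^N contracting E^s and expanding
   E^u by a factor 4 in suitable charts.

   The graph transform produces, through each x of B, a Lipschitz disk over a
   ball of E^u_x whose preimages under h^j lie in balls of radius O(3^-j) around
   h^-j(x). If B is an attractor the disk lies in B, hence in the surface, where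
   a disk of dimension 2 is open by invariance of domain; if E^u has rank 3 the
   disk is open in the manifold. In both cases x has a neighborhood O such that
   h^-j(B n O) lies in a ball of radius O(3^-j). By compactness finitely many,
   say k, such neighborhoods cover B, and the pigeonhole principle applied to
   the h^j-images of k + 1 points of B shows that B has at most k points. So B
   has covering dimension at most 0, which is absurd.

   Invariance of domain in the plane: if q is injective near 0, the map
   q(x) - q(0) on the unit circle is homotopic, through nonvanishing maps, to the
   odd map q(x/2) - q(-x/2). A nonvanishing odd map of the circle is not
   homotopic to a constant, so q(x) - y does not extend to the disk without a
   zero when y is near q(0). *)

Require Import Defs.
From mathcomp Require Import all_boot all_order all_algebra.
From mathcomp Require Import all_classical all_reals all_analysis.
From mathcomp Require Import ring lra.

Set Implicit Arguments.
Unset Strict Implicit.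
Unset Printing Implicit Defensive.

Import Order.TTheory GRing.Theory Num.Theory.
Import numFieldNormedType.Exports.

Local Open Scope classical_set_scope.
Local Open Scope ring_scope.

(** The graph transform needs one radius and one set of constants at all points of [B], although
    coordinates change from point to point. Each point selects one of finitely many charts, with no
    continuity in the selection, so every bound is proved near a point for all charts of the family
    and then made uniform by compactness. C^1 regularity enters as strict differentiability: its
    bound on pairs of points is exactly the Lipschitz error that the graph transform tolerates. With
    linear rates 4 and 1/4, an error of at most 1 leaves an expansion by 3 and keeps slopes below 1.

    The approximating disks are not shown to converge. A single ultrafilter on the number of steps
    gives pointwise limits, and all that is wanted of the limit disk is expressed by closed
    conditions. Its points stay in the trapping region at all backward times, and this is how
    attraction puts them in [B]. In rank 3 the disks of finite stage are already full balls and are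
    used directly. *)

Section RowNorm.
Variables (R : realType) (n : nat).
Implicit Types (v : 'rV[R]_n) (c : R).

Lemma rV_norm_leP v c : 0 <= c -> (`|v| <= c) <-> (forall i, `|v 0 i| <= c).
Proof.
move=> c0; rewrite (_ : `|v| = mx_norm v) // mx_normrE; split=> [|vc].
  by move=> /bigmax_leP[_ vc] i; exact: (vc (0, i)).
by apply/bigmax_leP; split=> // -[i j] _; rewrite (ord1 i).
Qed.

Lemma coord_le_norm v i : `|v 0 i| <= `|v|.
Proof. by move: i; apply/rV_norm_leP. Qed.

Lemma continuous_pair (T U V : topologicalType) (f : T -> U) (g : T -> V) x :
  {for x, continuous f} -> {for x, continuous g} ->
  {for x, continuous (fun y => (f y, g y))}.
Proof. by move=> cf cg; apply: (@cvg_pair _ _ _ _ (nbhs (f x)) (nbhs (g x))). Qed.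

Lemma continuous_coord (T : topologicalType) (g : T -> 'rV[R]_n) j x :
  {for x, continuous g} -> {for x, continuous (fun y => g y 0 j)}.
Proof.
move=> cg; apply: (@continuous_comp _ _ _ g (fun M : 'rV_n => M 0 j)) => //.
exact: coord_continuous.
Qed.

End RowNorm.

(** * Invariance of domain in the plane *)

Section PlanarRotation.
Variable R : realType.
Implicit Types (x y p q : 'rV[R]_2) (a b m : R).

Definition dot2 p q : R := p 0 0 * q 0 0 + p 0 1 * q 0 1.

Definition cross2 p q : R := p 0 0 * q 0 1 - p 0 1 * q 0 0.

Definition rot2 a p : 'rV[R]_2 :=
  \row_j (if j == 0 then cos a * p 0 0 - sin a * p 0 1
          else sin a * p 0 0 + cos a * p 0 1).

Lemma row2P p q : p 0 0 = q 0 0 -> p 0 1 = q 0 1 -> p = q.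
Proof.
move=> pq0 pq1; apply/rowP => j; rewrite -[j]natr_Zp /=.
by case: j => -[|[|[]]] //= ?; rewrite ?pq0 ?pq1.
Qed.

Lemma rot2_0 p : rot2 0 p = p.
Proof. by apply: row2P; rewrite !mxE /= cos0 sin0; ring. Qed.

Lemma rot2D a b p : rot2 a (rot2 b p) = rot2 (a + b) p.
Proof. by apply: row2P; rewrite !mxE /= cosD sinD; ring. Qed.

Lemma rot2Z a m p : rot2 a (m *: p) = m *: rot2 a p.
Proof. by apply: row2P; rewrite !mxE /=; ring. Qed.

Lemma rot2_eq0 a p : rot2 a p = 0 -> p = 0.
Proof.
by move/(congr1 (rot2 (- a))); rewrite rot2D addNr rot2_0 -(scale0r p) rot2Z !scale0r.
Qed.

Lemma dot2_gt0 p : p != 0 -> 0 < dot2 p p.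
Proof.
move=> p0; rewrite lt_neqAle eq_sym addr_ge0 ?andbT -?expr2 ?sqr_ge0 //.
apply: contra p0; rewrite paddr_eq0 -?expr2 ?sqr_ge0 // !sqrf_eq0.
by case/andP => /eqP p0 /eqP p1; apply/eqP; apply: row2P; rewrite mxE.
Qed.

(** With a positive scalar product the oriented angle from [p] to [q] lies strictly between -pi/2
    and pi/2, so [atan] yields it without a choice of branch, continuously in both vectors. The
    factor [m] is the ratio of the Euclidean lengths. *)
Lemma rot2_atan p q : 0 < dot2 p q ->
  exists2 m, 0 < m & q = m *: rot2 (atan (cross2 p q / dot2 p q)) p.
Proof.
move=> pq_gt0.
have p0 : p != 0.
  by apply: contraTneq pq_gt0 => ->; rewrite /dot2 !mxE !mul0r addr0 ltxx.
have pp_gt0 := dot2_gt0 p0.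
set t := cross2 p q / dot2 p q.
have s_gt0 : 0 < Num.sqrt (1 + t ^+ 2).
  by rewrite sqrtr_gt0 ltr_pwDl ?sqr_ge0.
have c_neq0 : cos (atan t) != 0 by rewrite cos_atan invr_eq0 gt_eqF.
exists (Num.sqrt (1 + t ^+ 2) * dot2 p q / dot2 p p).
  by rewrite divr_gt0 ?mulr_gt0.
have sinE : sin (atan t) = t * cos (atan t).
  have e : sin (atan t) / cos (atan t) = t := atanK t.
  by rewrite -[LHS](divfK c_neq0) e.
have ppN : dot2 p p != 0 by rewrite gt_eqF.
have pqN : dot2 p q != 0 by rewrite gt_eqF.
have sN : Num.sqrt (1 + t ^+ 2) != 0 by rewrite gt_eqF.
apply: row2P; rewrite !mxE /= sinE cos_atan; move: ppN pqN sN;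
  rewrite /t /cross2 /dot2 => ppN pqN; set s := Num.sqrt _ => sN; field; exact/and3P.
Qed.

End PlanarRotation.

Section RotationHomotopy.
Variable R : realType.
Implicit Types (X : set 'rV[R]_2) (p q r : 'rV[R]_2 -> 'rV[R]_2).

(* q / p, read as a map into the nonzero complex numbers, has a continuous
   argument on X. *)
Definition rot_related X p q : Prop :=
  exists a : 'rV[R]_2 -> R, (forall x, X x -> {for x, continuous a}) /\
    forall x, X x -> exists2 m, 0 < m & q x = m *: rot2 (a x) (p x).

Lemma rot_related_refl X p : rot_related X p p.
Proof.
exists (fun=> 0); split=> [x _|x Xx]; first exact: cst_continuous.
by exists 1; rewrite ?ltr01 // rot2_0 scale1r.
Qed.

Lemma rot_related_trans X p q r :
  rot_related X p q -> rot_related X q r -> rot_related X p r.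
Proof.
move=> [a [a_cont pq]] [b [b_cont qr]].
exists (fun x => b x + a x); split=> [x Xx|x Xx].
  by apply: continuousD; [exact: b_cont|exact: a_cont].
have [m m0 ->] := qr _ Xx; have [m' m'0 ->] := pq _ Xx.
exists (m * m'); first exact: mulr_gt0.
by rewrite rot2Z rot2D scalerA.
Qed.

Lemma continuous_dot2 (T : topologicalType) (p q : T -> 'rV[R]_2) x :
  {for x, continuous p} -> {for x, continuous q} ->
  {for x, continuous (fun y => dot2 (p y) (q y))}.
Proof.
move=> cp cq.
by apply: continuousD; apply: continuousM; exact: continuous_coord.
Qed.

Lemma continuous_cross2 (T : topologicalType) (p q : T -> 'rV[R]_2) x :
  {for x, continuous p} -> {for x, continuous q} ->
  {for x, continuous (fun y => cross2 (p y) (q y))}.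
Proof.
move=> cp cq.
by apply: continuousB; apply: continuousM; exact: continuous_coord.
Qed.

Lemma rot_related_dot_gt0 X p q : continuous p -> continuous q ->
  (forall x, X x -> 0 < dot2 (p x) (q x)) -> rot_related X p q.
Proof.
move=> cp cq pq.
exists (fun x => atan (cross2 (p x) (q x) / dot2 (p x) (q x))); split.
  move=> x Xx; apply: (@continuous_comp _ _ _
    (fun x => cross2 (p x) (q x) / dot2 (p x) (q x)) atan).
    apply: continuousM; first by apply: continuous_cross2; [exact: cp|exact: cq].
    apply: continuousV; last by apply: continuous_dot2; [exact: cp|exact: cq].
    by rewrite gt_eqF ?pq.
  exact: continuous_atan.
by move=> x Xx; exact/rot2_atan/pq.
Qed.

(** By compactness there is a time step [e] during which [G s x] turns by less than a right angle,
    for all [x] at once. The continuous angles over finitely many such steps add up. *)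
Lemma rot_related_homotopy X (G : R -> 'rV[R]_2 -> 'rV[R]_2) : compact X ->
  continuous (fun z : R * 'rV[R]_2 => G z.1 z.2) ->
  (forall s x, 0 <= s <= 1 -> X x -> G s x != 0) ->
  rot_related X (G 0) (G 1).
Proof.
move=> cX cG G_neq0.
have cGs s : continuous (G s).
  move=> x; apply: (@continuous_comp _ _ _ (fun x => (s, x))
    (fun z => G z.1 z.2)); last exact: cG.
  by apply: continuous_pair; [exact: cst_continuous|exact: cvg_id].
have [e e_gt0 Ge] : exists2 e : R, 0 < e & forall s s' x,
    0 <= s <= 1 -> X x -> `|s' - s| < e -> 0 < dot2 (G s x) (G s' x).
  have cK : compact ((`[0, 1]%classic : set R) `*` X).
    by apply: compact_setX => //; exact: segment_compact.
  have := (compact_near_coveringP _).1 cK R (0^'+)%R (fun e z =>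
    forall s', `|s' - z.1| < e -> 0 < dot2 (G z.1 z.2) (G s' z.2)).
  case.
    move=> [s x] [/= s01 Xx].
    pose H (z : (R * 'rV[R]_2) * R) := dot2 (G z.1.1 z.1.2) (G z.2 z.1.2).
    have cH : continuous H.
      move=> z; apply: continuous_dot2.
        apply: (@continuous_comp _ _ _ (fun z : (R * 'rV[R]_2) * R => z.1)
          (fun z => G z.1 z.2)); last exact: cG.
        exact: cvg_fst.
      apply: (@continuous_comp _ _ _ (fun z : (R * 'rV[R]_2) * R => (z.2, z.1.2))
        (fun z => G z.1 z.2)); last exact: cG.
      apply: continuous_pair; first exact: cvg_snd.
      by apply: (@cvg_comp _ _ _ (fun z : (R * 'rV[R]_2) * R => z.1) snd);
        [exact: cvg_fst|exact: cvg_snd].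
    have H0 : 0 < H ((s, x), s) by apply: dot2_gt0; apply: G_neq0; rewrite // -in_itv.
    have : \forall z \near ((s, x), s), 0 < H z.
      exact: (cH ((s, x), s) _ (lt_nbhsr H0)).
    move=> [[/= U V] [/= sxU sV] UV].
    have /nbhs_ballP[r /= r0 rV] := sV.
    have r20 : 0 < r / 2 by rewrite divr_gt0.
    exists (U `&` [set z | `|z.1 - s| < r / 2], [set e | e < r / 2]).
      split=> /=.
        apply: filterI => //.
        have /cvgrPdistC_lt/(_ _ r20) : z.1 @[z --> ((s, x) : R * 'rV[R]_2)] --> s.
          exact: cvg_fst.
        by [].
      exact: nbhs_right_lt.
    move=> [[s' x'] e] /= [[Us' ss'] er] t te.
    apply: (UV ((s', x'), t)); split=> //=.
    apply: rV; rewrite /ball /=.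
    rewrite (_ : s - t = (s - s') - (t - s')); last by ring.
    apply: le_lt_trans (ler_normB _ _) _.
    by rewrite (splitr r) ltrD // ?(lt_trans te) // distrC.
  move=> e e0 /(_ (e / 2)) He; exists (e / 2); first by rewrite divr_gt0.
  move=> s s' x s01 Xx ss'; apply: (He _ _ (s, x)) => //=.
  - by rewrite /= sub0r normrN gtr0_norm ?divr_gt0 // ltr_pdivrMr // ltr_pMr // ltr1n.
  - by rewrite divr_gt0.
pose N := (Num.truncn e^-1).+1.
have Ne : N%:R^-1 < e.
  rewrite invf_plt ?posrE ?ltr0n // truncnS_gt //.
suff rel k : (k <= N)%N -> rot_related X (G 0) (G (k%:R / N%:R)).
  by have := rel N (leqnn _); rewrite divff // pnatr_eq0.
elim: k => [_|k IH kN]; first by rewrite mul0r; exact: rot_related_refl.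
apply: rot_related_trans (IH (ltnW kN)) _.
apply: rot_related_dot_gt0 => // x Xx; apply: Ge => //.
  by rewrite divr_ge0 ?ler0n //= ler_pdivrMr ?ltr0n // mul1r ler_nat ltnW.
by rewrite -mulrBl -natr1 addrAC subrr add0r mul1r gtr0_norm ?invr_gt0 ?ltr0n.
Qed.

End RotationHomotopy.

Section PlanarInvarianceOfDomain.
Variable R : realType.
Implicit Types (p q : 'rV[R]_2 -> 'rV[R]_2).

Definition circle2 : set 'rV[R]_2 := [set x | dot2 x x = 1].

Definition circle_param (t : R) : 'rV[R]_2 :=
  \row_j (if j == 0 then cos t else sin t).

Lemma circle_paramP t : circle2 (circle_param t).
Proof. by rewrite /circle2 /dot2 /= !mxE /= -!expr2 cos2Dsin2. Qed.

Lemma circle_paramDpi t : circle_param (t + pi) = - circle_param t.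
Proof. by apply: row2P; rewrite !mxE /= ?cosDpi ?sinDpi. Qed.

Lemma row2E (x : 'rV[R]_2) : x = x 0 0 *: delta_mx 0 0 + x 0 1 *: delta_mx 0 1.
Proof. by apply: row2P; rewrite !mxE /=; ring. Qed.

Lemma circle_param_continuous : continuous circle_param.
Proof.
have -> : circle_param = (fun t => cos t *: delta_mx 0 0 + sin t *: delta_mx 0 1).
  by apply/funext => t; rewrite [LHS]row2E !mxE.
move=> t; apply: cvgD; apply: cvgZ; try exact: cvg_cst.
  exact: continuous_cos.
exact: continuous_sin.
Qed.

(** Row vectors carry the maximum norm, so unit balls are squares; the Euclidean circle lies inside
    the closed unit square. *)
Lemma circle2_norm x : circle2 x -> `|x| <= 1.
Proof.
rewrite /circle2 /dot2 /= -!expr2 => x1.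
apply/rV_norm_leP => // j.
rewrite -ler_sqr ?nnegrE ?ler01 // expr1n -normrX ger0_norm ?sqr_ge0 // -x1 -[j]natr_Zp.
by case: j => -[|[|[]]] //= ?; rewrite ?lerDl ?lerDr sqr_ge0.
Qed.

Lemma circle2_neq0 x : circle2 x -> x != 0.
Proof.
apply: contraPneq => ->; rewrite /circle2 /dot2 /= !mxE !mulr0 addr0 => /eqP.
by rewrite eq_sym oner_eq0.
Qed.

Lemma circle2_compact : compact circle2.
Proof.
apply: bounded_closed_compact.
  exists 1; split=> // M M1 x /circle2_norm x1; exact: le_trans x1 (ltW M1).
apply: (@closed_comp _ _ (fun x : 'rV[R]_2 => dot2 x x) [set 1]).
  by move=> x _; apply: continuous_dot2; exact: cvg_id.
by apply: compact_closed; [exact: norm_hausdorff|exact: compact_set1].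
Qed.

(** The difference [b] of the angles at antipodal points changes sign over a half turn, so it
    vanishes somewhere. There [q x] and [q (- x)] are positive multiples of one nonzero vector,
    contrary to oddness. *)
Lemma odd_not_rot_related_cst c q : c != 0 ->
  (forall x, circle2 x -> q (- x) = - q x) -> ~ rot_related circle2 (fun=> c) q.
Proof.
move=> c0 q_odd [a [ca aP]].
pose b t := a (circle_param (t + pi)) - a (circle_param t).
have cac : continuous (fun t => a (circle_param t)).
  move=> t; apply: (@continuous_comp _ _ _ circle_param a).
    exact: circle_param_continuous.
  exact/ca/circle_paramP.
have cb : continuous b.
  move=> t; apply: continuousB; last exact: cac.
  apply: (@continuous_comp _ _ _ (fun t => t + pi) (fun t => a (circle_param t))).
    by apply: continuousD; [exact: cvg_id|exact: cst_continuous].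
  exact: cac.
have bpi : b pi = - b 0.
  have gpi : circle_param pi = - circle_param 0 by rewrite -[pi]add0r circle_paramDpi.
  by rewrite /b circle_paramDpi add0r gpi opprK opprB.
have [] := @IVT R b 0 pi 0 (pi_ge0 _).
- exact: continuous_subspaceT.
- rewrite bpi; case: (lerP (b 0) 0) => b0.
    by rewrite min_l ?max_r // ?oppr_ge0 ?b0 // (le_trans b0) // oppr_ge0.
  by rewrite min_r ?max_l ?oppr_le0 ?ltW //; rewrite (lt_trans _ b0) // oppr_lt0.
move=> t _ /eqP; rewrite subr_eq0 => /eqP bt.
have [m m0 qt] := aP _ (circle_paramP t).
have [m' m'0] := aP _ (circle_paramP (t + pi)).
rewrite bt circle_paramDpi q_odd ?qt; last exact: circle_paramP.
move/eqP; rewrite -subr_eq0 -opprD oppr_eq0 -scalerDl scaler_eq0.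
by rewrite gt_eqF ?addr_gt0 //= => /eqP /rot2_eq0; exact/eqP.
Qed.

Lemma planar_invariance_of_domain q : continuous q ->
  {in [set x | `|x| <= 1] &, injective q} ->
  nbhs (q 0) (q @` [set x | `|x| <= 1]).
Proof.
move=> cq q_inj.
have q_inj' x y : `|x| <= 1 -> `|y| <= 1 -> q x = q y -> x = y.
  by move=> x1 y1; apply: q_inj; rewrite inE.
have scale1 s x : 0 <= s <= 1 -> circle2 x -> `|s *: x| <= 1.
  move=> /andP[s0 s1] /circle2_norm x1.
  by rewrite normrZ ger0_norm // mulr_ile1.
have cl : closed (q @` circle2).
  apply: compact_closed; first exact: norm_hausdorff.
  apply: continuous_compact; last exact: circle2_compact.
  exact: continuous_subspaceT.
have : nbhs (q 0) (~` (q @` circle2)).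
  apply: open_nbhs_nbhs; split; first exact: closed_openC.
  move=> [x Xx /q_inj' x0]; move: (circle2_neq0 Xx).
  by move: (x0 (circle2_norm Xx)) => ->; rewrite ?normr0 ?ler01 ?eqxx.
move=> /nbhs_ballP[e /= e0 qe].
apply/nbhs_ballP; exists e => // y yb; apply: contrapT => yN.
have y_neq x : `|x| <= 1 -> q x - y != 0.
  by move=> x1; apply/eqP => /subr0_eq xy; apply: yN; exists x.
have cscale (k : R -> R) : continuous k ->
    continuous (fun z : R * 'rV[R]_2 => q (k z.1 *: z.2)).
  move=> ck z.
  apply: (@continuous_comp _ _ _ (fun z : R * 'rV[R]_2 => k z.1 *: z.2)); last exact: cq.
  apply: cvgZ; last exact: cvg_snd.
  by apply: (@cvg_comp _ _ _ fst k); [exact: cvg_fst|exact: ck].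
(* [h1] grows the circle from the point 0 and meets no zero because [y] is assumed not to be a
   value; [h2] slides [y] to [q 0] inside a ball that misses the image of the circle. *)
have h1 : rot_related circle2 (fun x => q (0 *: x) - y) (fun x => q (1 *: x) - y).
  apply: (@rot_related_homotopy _ _ (fun s x => q (s *: x) - y)).
  - exact: circle2_compact.
  - move=> z; apply: continuousB; last exact: cst_continuous.
    by apply: (cscale id) => ?; exact: cvg_id.
  - by move=> s x s01 Xx; apply: y_neq; exact: scale1.
have h2 : rot_related circle2 (fun x => q x - (y + 0 *: (q 0 - y)))
    (fun x => q x - (y + 1 *: (q 0 - y))).
  apply: (@rot_related_homotopy _ _ (fun s x => q x - (y + s *: (q 0 - y)))).
  - exact: circle2_compact.
  - move=> z; apply: cvgB.
      by apply: (@continuous_comp _ _ _ snd q); [exact: cvg_snd|exact: cq].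
    apply: cvgD; first exact: cvg_cst.
    by apply: cvgZ; [exact: cvg_fst|exact: cvg_cst].
  - move=> s x /andP[s0 s1] Xx; apply/eqP => /subr0_eq qx.
    apply: (qe (y + s *: (q 0 - y))); last by exists x.
    move: yb; rewrite -ball_normE /= => yb.
    rewrite opprD addrA -[X in `|X - _|]scale1r -scalerBl normrZ.
    by rewrite ger0_norm ?subr_ge0 // (le_lt_trans _ yb) // ler_piMl // gerBl.
(* Injectivity enters here: at a zero the two arguments would agree, but their coefficients
   [1 - s / 2] and [- (s / 2)] differ by 1, which forces [x = 0]. At [s = 1] the map is odd. *)
have h3 : rot_related circle2
    (fun x => q ((1 - 0 / 2) *: x) - q ((- (0 / 2)) *: x))
    (fun x => q ((1 - 1 / 2) *: x) - q ((- (1 / 2)) *: x)).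
  apply: (@rot_related_homotopy _ _
    (fun s x => q ((1 - s / 2) *: x) - q ((- (s / 2)) *: x))).
  - exact: circle2_compact.
  - move=> z; apply: cvgB.
      apply: (cscale (fun s => 1 - s / 2)) => s.
      apply: cvgB; first exact: cvg_cst.
      by apply: cvgM; [exact: cvg_id|exact: cvg_cst].
    apply: (cscale (fun s => - (s / 2))) => s; apply: cvgN.
    by apply: cvgM; [exact: cvg_id|exact: cvg_cst].
  - move=> s x /andP[s0 s1] Xx; apply/eqP => /subr0_eq /q_inj' e1.
    have : (1 - s / 2) *: x = (- (s / 2)) *: x.
      apply: e1; first by apply: scale1 => //; lra.
      by rewrite scaleNr normrN; apply: scale1 => //; lra.
    move/eqP; rewrite -subr_eq0 -scalerBl opprK subrK scale1r.
    exact/negP/circle2_neq0.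
have e1 x : q x - (y + 1 *: (q 0 - y)) = q ((1 - 0 / 2) *: x) - q ((- (0 / 2)) *: x).
  by rewrite mul0r subr0 oppr0 !scale1r scale0r [y + _]addrC subrK.
have e2 x : q (1 *: x) - y = q x - (y + 0 *: (q 0 - y)).
  by rewrite scale1r scale0r addr0.
have e3 (x : 'rV[R]_2) : q (0 *: x) - y = q 0 - y by rewrite scale0r.
move/funext: e1 => e1; move/funext: e2 => e2; move/funext: e3 => e3.
rewrite e2 e3 in h1; rewrite e1 in h2.
have := rot_related_trans h1 (rot_related_trans h2 h3).
apply: odd_not_rot_related_cst; first by apply: y_neq; rewrite normr0 ler01.
have half : 1 - 1 / 2 = 1 / 2 :> R by lra.
by move=> x _; rewrite !half !scalerN !scaleNr opprK opprB.
Qed.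

End PlanarInvarianceOfDomain.

(** * Strict differentiability *)

Section StrictDifferential.
Variable R : realType.

(* Strict differentiability of F at p, with differential v |-> v *m A. Unlike
   differentiability it bounds F on all pairs near p, so it both survives
   composition and yields uniform estimates on compact sets. *)
Definition sdiff n m (F : 'rV[R]_n -> 'rV[R]_m) (p : 'rV[R]_n)
    (A : 'M[R]_(n, m)) : Prop :=
  forall eta, 0 < eta -> exists2 d, 0 < d & forall v w,
    `|v - p| < d -> `|w - p| < d -> `|F v - F w - (v - w) *m A| <= eta * `|v - w|.

Lemma norm_mulmx n m (v : 'rV[R]_n) (A : 'M[R]_(n, m)) :
  `|v *m A| <= n%:R * `|A| * `|v|.
Proof.
apply/rV_norm_leP => [|j]; first by rewrite !mulr_ge0.
rewrite mxE (le_trans (ler_norm_sum _ _ _)) //.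
have -> : n%:R * `|A| * `|v| = \sum_(i < n) `|A| * `|v|.
  by rewrite sumr_const card_ord -mulrA mulr_natl.
apply: ler_sum => i _.
rewrite normrM mulrC ler_pM ?coord_le_norm //.
rewrite (_ : `|A| = mx_norm A) // mx_normrE.
exact: (le_bigmax _ (fun ij => `|A ij.1 ij.2|) (i, j)).
Qed.

Lemma mulmx_continuous n m (A : 'M[R]_(n, m)) :
  continuous (mulmxr A : 'rV[R]_n -> 'rV[R]_m).
Proof.
apply: bounded_linear_continuous; apply/linear_boundedP.
exists (n%:R * `|A|); split; first exact: num_real.
move=> M MA v; apply: le_trans (norm_mulmx _ _) _.
by rewrite ler_wpM2r // ltW.
Qed.

Lemma sdiff_eq n m (F G : 'rV[R]_n -> 'rV[R]_m) p A :
  (\forall v \near p, F v = G v) -> sdiff F p A -> sdiff G p A.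
Proof.
move=> /nbhs_ballP[e /= e0 FG] dF eta /dF[d d0 Fd].
exists (Num.min d e) => [|v w]; first by rewrite lt_min d0.
rewrite !lt_min => /andP[vd ve] /andP[wd we].
by rewrite -!FG ?Fd // -ball_normE /= distrC.
Qed.

Lemma sdiff_id n p : sdiff (fun v : 'rV[R]_n => v) p 1%:M.
Proof.
move=> eta eta0; exists 1 => // v w _ _; rewrite mulmx1 subrr normr0.
by rewrite mulr_ge0 // ltW.
Qed.

Lemma sdiff_lipschitz n m (F : 'rV[R]_n -> 'rV[R]_m) p A : sdiff F p A ->
  exists2 K, 0 < K & exists2 d, 0 < d & forall v w,
    `|v - p| < d -> `|w - p| < d -> `|F v - F w| <= K * `|v - w|.
Proof.
move=> /(_ _ ltr01) [d d0 dF]; exists (1 + n%:R * `|A|).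
  by rewrite ltr_pwDl // mulr_ge0.
exists d => // v w vd wd.
rewrite -[F v - F w](subrK ((v - w) *m A)) (le_trans (ler_normD _ _)) //.
by rewrite mulrDl lerD ?dF ?norm_mulmx.
Qed.

Lemma sdiff_comp n m k (F : 'rV[R]_n -> 'rV[R]_m) (G : 'rV[R]_m -> 'rV[R]_k) p A B :
  sdiff F p A -> sdiff G (F p) B -> sdiff (G \o F) p (A *m B).
Proof.
move=> dF dG eta eta0.
have [K K0 [d1 d10 FK]] := sdiff_lipschitz dF.
have [d2 d20 dG2] := dG (eta / 2 / K) (divr_gt0 (divr_gt0 eta0 (ltr0Sn _ 1)) K0).
set L := m%:R * `|B| + 1.
have L0 : 0 < L by rewrite ltr_wpDl // mulr_ge0.
have [d3 d30 dF3] := dF (eta / 2 / L) (divr_gt0 (divr_gt0 eta0 (ltr0Sn _ 1)) L0).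
have d2K : 0 < d2 / K by rewrite divr_gt0.
exists (Num.min d1 (Num.min d3 (d2 / K))) => [|v w]; first by rewrite !lt_min d10 d30.
rewrite !lt_min => /and3P[v1 v3 v2] /and3P[w1 w3 w2] /=.
have Fp x : `|x - p| < d1 -> `|x - p| < d2 / K -> `|F x - F p| < d2.
  move=> x1 x2; apply: le_lt_trans (FK x p _ _) _; rewrite ?subrr ?normr0 //.
  by rewrite mulrC -ltr_pdivlMr.
rewrite mulmxA -(subrK ((F v - F w) *m B) (G (F v) - G (F w))) -addrA -mulmxBl.
rewrite (le_trans (ler_normD _ _)) // (splitr eta) mulrDl lerD //.
  apply: le_trans (dG2 _ _ (Fp _ v1 v2) (Fp _ w1 w2)) _.
  rewrite -mulrA; apply: ler_wpM2l; first by rewrite divr_ge0 // ltW.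
  by rewrite mulrC ler_pdivrMr // mulrC FK.
apply: le_trans (norm_mulmx _ _) _.
apply: (@le_trans _ _ (L * `|F v - F w - (v - w) *m A|)).
  by rewrite ler_wpM2r // lerDl.
by rewrite mulrC -ler_pdivlMr // mulrAC dF3.
Qed.

Lemma sdiff_jacobian n m (F : 'rV[R]_n -> 'rV[R]_m) p A : sdiff F p A ->
  'J F p = A.
Proof.
move=> dF; suff dE : 'd F p = mulmxr A :> ('rV[R]_n -> 'rV[R]_m).
  by apply/row_matrixP => i; rewrite !rowE mul_rV_lin1 dE.
apply: diff_unique; first exact: mulmx_continuous.
apply/eqaddoP => eta eta0; have [d d0 dF1] := dF eta eta0.
apply/nbhs_ballP; exists d => //= v; rewrite -ball_normE /= sub0r normrN => vd.
have := dF1 (v + p) p; rewrite addrK subrr normr0 => /(_ vd d0).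
by rewrite !fctE /= opprD addrA.
Qed.

(** The estimate at [p] also covers pairs of points near [q]; comparing it with the estimate at [q]
    along a short multiple of [w] bounds the difference of the differentials. Continuity of the
    differential is thus built into strict differentiability. *)
Lemma sdiff_near n m (F : 'rV[R]_n -> 'rV[R]_m) p A : sdiff F p A ->
  forall eta, 0 < eta -> exists2 d, 0 < d & forall q B,
    `|q - p| < d -> sdiff F q B -> forall w : 'rV_n, `|w *m (B - A)| <= eta * `|w|.
Proof.
move=> dF eta eta0.
have eta20 : 0 < eta / 2 by rewrite divr_gt0.
have [d d0 dF1] := dF _ eta20; exists d => // q B qd dB w.
have [e e0 dB1] := dB _ eta20.
have [->|w0] := eqVneq w 0; first by rewrite mul0mx !normr0 mulr0.
have wgt0 : 0 < `|w| by rewrite normr_gt0.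
(* [t *: w] takes up half of the available room, so [t *: w + q] stays in both neighborhoods. *)
pose t := Num.min e (d - `|q - p|) / 2 / `|w|.
have m0 : 0 < Num.min e (d - `|q - p|) by rewrite lt_min e0 subr_gt0.
have t0 : 0 < t by rewrite !divr_gt0.
have tw : `|t *: w| < Num.min e (d - `|q - p|).
  by rewrite normrZ gtr0_norm // /t divfK ?gt_eqF // ltr_pdivrMr // ltr_pMr // ltr1n.
move: tw; rewrite lt_min => /andP[twe twd].
have := dB1 (t *: w + q) q; rewrite addrK subrr normr0 => /(_ twe e0) h1.
have := dF1 (t *: w + q) q; rewrite addrK => /(_ _ qd) h2.
have {}h2 := h2 _; rewrite -(ler_pM2l t0).
have -> : t * `|w *m (B - A)| = `|t *: w *m (B - A)|.
  by rewrite -scalemxAl normrZ (gtr0_norm t0).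
have -> : t *: w *m (B - A) = (F (t *: w + q) - F q - t *: w *m A) -
    (F (t *: w + q) - F q - t *: w *m B).
  by rewrite mulmxBr opprB [RHS]addrC addrA subrK.
rewrite (le_trans (ler_normB _ _)) // mulrCA -(gtr0_norm t0) -normrZ (gtr0_norm t0).
rewrite [eta in leRHS]splitr mulrDl lerD // h2 //.
by rewrite -addrA (le_lt_trans (ler_normD _ _)) // -ltrBrDr.
Qed.

Lemma is_derive_line n m (F : 'rV[R]_n -> 'rV[R]_m) (x w : 'rV[R]_n) (t : R) :
  differentiable F (x + t *: w) ->
  is_derive t 1 (fun s => F (x + s *: w)) ('d F (x + t *: w) w).
Proof.
move=> dF.
have E : (fun h : R => h^-1 *: (F (x + (h *: 1 + t) *: w) - F (x + t *: w))) =
    (fun h => h^-1 *: (F (h *: w + (x + t *: w)) - F (x + t *: w))).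
  apply/funext => h; congr (_ *: (F _ - _)).
  by rewrite scalerDl addrCA [_ *: 1]mulr1.
have dF' : derivable F (x + t *: w) w by exact: diff_derivable.
apply: DeriveDef.
  by move: dF'; rewrite /derivable E.
by rewrite [LHS](congr1 (fun k => lim (k @ 0^')) E) -deriveE.
Qed.

(** The mean value theorem on the segment from [w] to [v], applied to one coordinate at a time
    because the intermediate point depends on the coordinate. Closeness of the differentials on
    basis vectors then suffices, by linearity. *)
Lemma Ck1_sdiff n m (U : set 'rV[R]_n) (F : 'rV[R]_n -> 'rV[R]_m) p :
  open U -> U p -> Ck_on 1 U F -> sdiff F p ('J F p).
Proof.
move=> oU Up [dF cF] eta eta0.
(* Each of the [n] basis directions contributes at most this much; [n.+1] avoids a division by 0
   when [n = 0]. *)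
have e0 : 0 < eta / n.+1%:R by rewrite divr_gt0.
have : \forall x \near p, U x /\ forall i : 'I_n,
    `|'d F p (delta_mx 0 i) - 'd F x (delta_mx 0 i)| < eta / n.+1%:R.
  apply: filterI; first exact: open_nbhs_nbhs.
  apply: (@filter_forall _ 'I_n (fun i x => `|'d F p (delta_mx 0 i) -
    'd F x (delta_mx 0 i)| < eta / n.+1%:R) _ (nbhs_filter p)) => i.
  have := cF (delta_mx 0 i) p; rewrite inE => /(_ Up).
  by move=> /(@cvgrPdist_lt _ _ _ _ (nbhs_filter p)); exact.
move=> /nbhs_ballP[d /= d0 dP]; exists d => // v w vd wd.
have line_in t : 0 <= t <= 1 -> ball p d (w + t *: (v - w)).
  move=> /andP[t0 t1]; rewrite -ball_normE /= distrC.
  have -> : w + t *: (v - w) - p = (1 - t) *: (w - p) + t *: (v - p).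
    by apply/rowP => i; rewrite !mxE; ring.
  have [->|t_neq0] := eqVneq t 0; first by rewrite subr0 scale1r scale0r addr0.
  have tgt0 : 0 < t by rewrite lt_neqAle eq_sym t_neq0.
  rewrite (le_lt_trans (ler_normD _ _)) // !normrZ (ger0_norm t0) ger0_norm ?subr_ge0 //.
  have -> : d = (1 - t) * d + t * d by ring.
  by rewrite ler_ltD ?ltr_pM2l // ler_wpM2l ?subr_ge0 // ltW.
apply/rV_norm_leP => [|j]; first by rewrite mulr_ge0 // ltW.
pose g t := F (w + t *: (v - w)).
have dg (t : R) : 0 <= t <= 1 ->
    is_derive t 1 (fun s : R => g s 0 j) ('d F (w + t *: (v - w)) (v - w) 0 j).
  move=> t01; have /dP[Ut _] := line_in _ t01.
  have [dg gE] := is_derive_line (dF _ (mem_set Ut)).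
  apply: DeriveDef; first by move/derivable_mxP : dg; exact.
  by rewrite -gE derive_mx // mxE.
have [||t t01] := @MVT_segment R (fun s => g s 0 j)
    (fun t => 'd F (w + t *: (v - w)) (v - w) 0 j) 0 1 ler01.
- by move=> t; rewrite in_itv /= => /andP[t0 t1]; apply: dg; rewrite !ltW.
- apply/continuous_within_itvP => //; split.
  + move=> t; rewrite in_itv /= => /andP[t0 t1].
    have /dg dgt : 0 <= t <= 1 by rewrite !ltW.
    by apply/differentiable_continuous/derivable1_diffP.
  + apply/cvg_at_right_filter.
    have /dg dgt : 0 <= (0 : R) <= 1 by rewrite lexx ler01.
    by apply/differentiable_continuous/derivable1_diffP.
  + apply/cvg_at_left_filter.
    have /dg dgt : 0 <= (1 : R) <= 1 by rewrite lexx ler01.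
    by apply/differentiable_continuous/derivable1_diffP.
rewrite /g scale1r scale0r addr0 [w + _]addrC subrK subr0 mulr1 => FE.
have {}t01 : 0 <= t <= 1 by move: t01; rewrite in_itv.
have [_ dFt] := dP _ (line_in _ t01).
set z := w + t *: (v - w) in FE dFt *.
have -> : (F v - F w - (v - w) *m 'J F p) 0 j = ('d F z (v - w) - 'd F p (v - w)) 0 j.
  by rewrite mul_rV_lin1 [LHS]mxE [RHS]mxE; congr (_ + _); rewrite -FE !mxE.
apply: le_trans (coord_le_norm _ _) _.
have lin x (u : 'rV_n) : 'd F x u = \sum_(i < n) u 0 i *: 'd F x (delta_mx 0 i).
  rewrite [in LHS](row_sum_delta u) linear_sum /=.
  by apply: eq_bigr => i _; rewrite linearZ.
have lz := lin z (v - w).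
have lp := lin p (v - w).
have -> : 'd F z (v - w) - 'd F p (v - w) = \sum_(i < n) (v - w) 0 i *:
    ('d F z (delta_mx 0 i) - 'd F p (delta_mx 0 i)).
  apply: etrans (congr2 (fun a b => a - b) lz lp) _; rewrite -sumrB.
  by apply: eq_bigr => i _; rewrite scalerBr.
apply: le_trans (ler_norm_sum _ _ _) _.
apply: (@le_trans _ _ (\sum_(i < n) (eta / n.+1%:R * `|v - w|))).
  apply: ler_sum => i _; rewrite normrZ mulrC.
  by rewrite ler_pM ?coord_le_norm // distrC ltW.
rewrite sumr_const card_ord -[leLHS]mulr_natl mulrA ler_wpM2r //.
rewrite mulrCA; apply: ler_piMr; first exact: ltW.
by rewrite ler_pdivrMr // mul1r ler_nat.
Qed.

End StrictDifferential.

(** * Graph transform *)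

Section GraphTransform.
Variables (R : realType) (n : nat).
Implicit Types (P Q A B : 'M[R]_n) (G D : set 'rV[R]_n) (d : R).

Lemma lipschitz_within_continuous m D (f : 'rV[R]_n -> 'rV[R]_m) K :
  (forall v w, D v -> D w -> `|f v - f w| <= K * `|v - w|) ->
  {within D, continuous f}.
Proof.
move=> fK; apply/subspace_continuousP => v Dv.
have FF := @within_filter _ D _ (nbhs_filter v).
apply/(@cvgrPdist_lt _ _ _ _ FF) => e e0.
have K0 : 0 < `|K| + 1 by rewrite ltr_wpDl.
have ed : 0 < e / (`|K| + 1) by rewrite divr_gt0.
apply/nbhs_ballP; exists (e / (`|K| + 1)) => //= w; rewrite -ball_normE /= => vw Dw.
apply: le_lt_trans (fK _ _ Dv Dw) _.
apply: (@le_lt_trans _ _ ((`|K| + 1) * `|v - w|)).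
  by rewrite ler_wpM2r // (le_trans (ler_norm K)) // lerDl.
by rewrite mulrC -ltr_pdivlMr.
Qed.

(* The displacement |T v - v| attains its minimum on D; applying T once more
   halves it, so the minimum is 0. *)
Lemma compact_contraction_fixpoint D (T : 'rV[R]_n -> 'rV[R]_n) :
  compact D -> D !=set0 -> (forall v, D v -> D (T v)) ->
  (forall v w, D v -> D w -> `|T v - T w| <= 2^-1 * `|v - w|) ->
  exists2 v, D v & T v = v.
Proof.
move=> cD D0 DT Tc.
have TK v w : D v -> D w -> `|(T v - v) - (T w - w)| <= (2^-1 + 1) * `|v - w|.
  move=> Dv Dw; have -> : T v - v - (T w - w) = (T v - T w) - (v - w).
    by apply/rowP => i; rewrite !mxE; ring.
  by rewrite (le_trans (ler_normB _ _)) // mulrDl mul1r lerD2r Tc.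
have cT : {within D, continuous (fun v => `|T v - v|)}.
  move=> v; apply: (@continuous_comp _ _ _ (fun v : subspace D => T v - v)
    (fun v : 'rV_n => `|v|)); last exact: norm_continuous.
  exact: (lipschitz_within_continuous TK).
have [v] := compact_EVT_min D0 cD cT; rewrite inE => Dv vmin; exists v => //.
have /vmin : T v \in D by rewrite inE; exact: DT.
move=> /le_trans /(_ (Tc _ _ (DT _ Dv) Dv)).
rewrite -{1}[`|T v - v|]mul1r -subr_le0 -mulrBl => h.
have /eqP : `|T v - v| = 0.
  by apply/eqP; rewrite eq_le normr_ge0 andbT; lra.
by rewrite normr_eq0 subr_eq0 => /eqP.
Qed.

(* G is the graph of a 1-Lipschitz map from the ball of radius d of the range
   of the projection P to its kernel, vanishing at 0. *)
Definition graph_over P d G : Prop :=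
  [/\ G 0, forall v, G v -> `|v *m P| <= d,
      forall v w, G v -> G w -> `|(v - w) *m (1%:M - P)| <= `|(v - w) *m P| &
      forall w, w *m P = w -> `|w| <= d -> exists2 v, G v & v *m P = w].

Lemma graph_over_norm P d G v w : graph_over P d G -> G v -> G w ->
  `|v - w| <= 2 * `|(v - w) *m P|.
Proof.
move=> [_ _ GL _] Gv Gw.
rewrite -[X in `|X| <= _](mulmx1 (v - w)) -[1%:M](subrK P) mulmxDr.
by rewrite (le_trans (ler_normD _ _)) // mulr2n mulrDl !mul1r lerD2r GL.
Qed.

(** [A] is the differential and [B] its inverse; [P] and [P'] project to the unstable directions at
    the source and at the target. The condition [etaK] makes the nonlinear error on two points of a
    graph at most [|(v - w) *m P|]. So the unstable rate drops from 4 to 3, while the stable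
    component of the image stays below 2 times [|(v - w) *m P|], and slopes remain at most 1. *)
Variables (P P' A B : 'M[R]_n) (F : 'rV[R]_n -> 'rV[R]_n) (d eta K : R).
Hypotheses (PP : P *m P = P) (P'P' : P' *m P' = P') (PA : P *m A = A *m P').
Hypotheses (AB : A *m B = 1%:M) (BA : B *m A = 1%:M).
Hypothesis B_contr : forall v : 'rV[R]_n, v *m P' = v -> `|v *m B| <= 4^-1 * `|v|.
Hypothesis A_contr : forall v : 'rV[R]_n, v *m P = 0 -> `|v *m A| <= 4^-1 * `|v|.
Hypothesis P'K : forall v : 'rV[R]_n, `|v *m P'| <= K * `|v|.
Hypothesis Q'K : forall v : 'rV[R]_n, `|v *m (1%:M - P')| <= K * `|v|.
Hypothesis d_ge0 : 0 <= d.
Hypotheses (eta_ge0 : 0 <= eta) (etaK : 2 * eta * K <= 1) (F0 : F 0 = 0).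
Hypothesis F_approx : forall v w, `|v| <= 2 * d -> `|w| <= 2 * d ->
  `|F v - F w - (v - w) *m A| <= eta * `|v - w|.

Lemma expand_range (v : 'rV[R]_n) : 4 * `|v *m P| <= `|v *m P *m A|.
Proof.
have -> : v *m P = v *m P *m A *m B by rewrite -[RHS]mulmxA AB mulmx1.
have := @B_contr (v *m P *m A).
rewrite -mulmxA -PA mulmxA -[v *m P *m P]mulmxA PP -[v *m P *m A *m B *m A]mulmxA BA mulmx1.
by move=> /(_ erefl); lra.
Qed.

(** The image of an expanded graph overflows the ball of radius [d], hence the cut. *)
Definition graph_image G := [set u | exists2 v, G v & u = F v /\ `|F v *m P'| <= d].

Variable G : set 'rV[R]_n.
Hypothesis G_graph : graph_over P d G.

Lemma graph_small v : G v -> `|v| <= 2 * d.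
Proof.
have [G0 Gd _ _] := G_graph => Gv; have := graph_over_norm G_graph Gv G0.
rewrite !subr0 => /le_trans; apply; rewrite ler_wpM2l //; exact: Gd.
Qed.

Lemma graph_error v w : G v -> G w ->
  `|(F v - F w - (v - w) *m A) *m P'| <= `|(v - w) *m P| /\
  `|(F v - F w - (v - w) *m A) *m (1%:M - P')| <= `|(v - w) *m P|.
Proof.
move=> Gv Gw.
(* By [P'K], a negative [K] forces every vector to be 0. *)
have K_ge0 : 0 <= K \/ forall u : 'rV[R]_n, u = 0.
  have [|K0] := lerP 0 K; [by left|right] => u; apply/eqP.
  by have := le_trans (normr_ge0 _) (P'K u); rewrite nmulr_rge0 // normr_le0.
case: K_ge0 => [K0|triv]; last first.
  by rewrite (triv (_ *m P')) (triv (_ *m (1%:M - P'))) normr0.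
have le u : `|u| <= eta * `|v - w| -> K * `|u| <= `|(v - w) *m P|.
  move=> uP; apply: le_trans (ler_wpM2l K0 uP) _.
  apply: (@le_trans _ _ (K * (eta * (2 * `|(v - w) *m P|)))).
    by rewrite !ler_wpM2l // (graph_over_norm G_graph).
  have -> : K * (eta * (2 * `|(v - w) *m P|)) = 2 * eta * K * `|(v - w) *m P| by ring.
  exact: ler_piMl.
have e := F_approx (graph_small Gv) (graph_small Gw).
by split; [apply: le_trans (P'K _) _|apply: le_trans (Q'K _) _]; exact: le.
Qed.

Lemma graph_expand v w : G v -> G w ->
  3 * `|(v - w) *m P| <= `|(F v - F w) *m P'|.
Proof.
move=> Gv Gw; have [e _] := graph_error Gv Gw.
have : `|(v - w) *m A *m P'| <= `|(F v - F w) *m P'| + `|(v - w) *m P|.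
  apply: le_trans (lerD (lexx _) e).
  have -> : (v - w) *m A *m P' =
      (F v - F w) *m P' - (F v - F w - (v - w) *m A) *m P'.
    by rewrite -mulmxBl subKr.
  exact: ler_normB.
rewrite -mulmxA -PA mulmxA; have := expand_range (v - w); lra.
Qed.

Lemma graph_over_image : graph_over P' d (graph_image G).
Proof.
have [G0 Gd GL Gonto] := G_graph; split.
- by exists 0; rewrite // F0 mul0mx normr0.
- by move=> _ [v _ [-> ?]].
- move=> _ _ [v Gv [-> _]] [w Gw [-> _]].
  apply: le_trans (graph_expand Gv Gw).
  have [_ e] := graph_error Gv Gw.
  have c : `|(v - w) *m A *m (1%:M - P')| <= `|(v - w) *m P|.
    have -> : (v - w) *m A *m (1%:M - P') = (v - w) *m (1%:M - P) *m A.
      by rewrite -!mulmxA; congr (_ *m _); rewrite mulmxBr mulmxBl mulmx1 mul1mx PA.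
    apply: le_trans (@A_contr _ _) _.
      by rewrite -mulmxA [(1%:M - P) *m P]mulmxBl mul1mx PP subrr mulmx0.
    by have := GL _ _ Gv Gw; have := normr_ge0 ((v - w) *m P); lra.
  rewrite -[F v - F w](subrK ((v - w) *m A)) mulmxDl.
  apply: le_trans (ler_normD _ _) _.
  by have := normr_ge0 ((v - w) *m P); lra.
move=> w' w'P' w'd.
have [g gP] : {g : 'rV[R]_n -> 'rV[R]_n & forall w, w *m P = w -> `|w| <= d ->
    G (g w) /\ g w *m P = w}.
  apply: (@choice _ _ (fun w v => w *m P = w -> `|w| <= d -> G v /\ v *m P = w)) => w.
  have [/Gonto h|] := pselect (w *m P = w); last by exists 0.
  by have [/h [v]|] := pselect (`|w| <= d); [exists v|exists 0].
pose D := [set w : 'rV[R]_n | w *m P = w /\ `|w| <= d].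
have BP' : P' *m B = B *m P.
  by rewrite -[LHS]mul1mx -BA -!mulmxA [A *m (_ *m _)]mulmxA -PA -!mulmxA AB mulmx1.
(* A Newton step with frozen derivative for the equation [F (g w) *m P' = w']. Its linear part
   cancels, and [B] divides the remaining error by 4. *)
pose T w := w + (w' - F (g w) *m P') *m B.
have Tc v w : D v -> D w -> `|T v - T w| <= 4^-1 * `|v - w|.
  move=> [vP vd] [wP wd]; have [Gv gv] := gP _ vP vd; have [Gw gw] := gP _ wP wd.
  have [e _] := graph_error Gv Gw.
  have -> : T v - T w = - ((F (g v) - F (g w) - (g v - g w) *m A) *m P' *m B).
    rewrite [_ *m P']mulmxBl -[_ *m A *m P']mulmxA -PA mulmxBl.
    have -> : (g v - g w) *m (P *m A) *m B = v - w.
      by rewrite -!mulmxA AB mulmx1 mulmxBl gv gw.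
    rewrite /T !mulmxBl.
    move: (w' *m B) (F (g v) *m P' *m B) (F (g w) *m P' *m B) => X Y Z.
    by apply/rowP => i; rewrite !mxE; ring.
  rewrite normrN; apply: le_trans (B_contr _) _; first by rewrite -mulmxA P'P'.
  by rewrite ler_wpM2l // (le_trans e) // mulmxBl gv gw.
(* On [D], [T w] is within [d / 4] of [T 0 = w' *m B], which itself has norm at most [d / 4]. *)
have DT w : D w -> D (T w).
  move=> Dw; have [wP wd] := Dw; split.
    rewrite mulmxDl wP -mulmxA -BP' mulmxA mulmxBl w'P' -mulmxA P'P' //.
  have D0 : D 0 by split; rewrite ?mul0mx ?normr0.
  have T0 : T 0 = w' *m B.
    have [z0 z1] := D0; have [Gg g0] := gP _ z0 z1.
    have g00 : g 0 = 0.
      have := graph_over_norm G_graph Gg G0.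
      by rewrite !subr0 g0 normr0 mulr0 normr_le0 => /eqP.
    by rewrite /T g00 F0 mul0mx subr0 add0r.
  have := Tc _ _ Dw D0; rewrite subr0 T0 => h.
  have h2 := B_contr w'P'.
  rewrite -[T w](subrK (w' *m B)); apply: le_trans (ler_normD _ _) _.
  rewrite (le_trans (lerD h h2)) // -mulrDr.
  rewrite (le_trans (ler_wpM2l _ (lerD wd w'd))) //.
  by have := d_ge0; lra.
have cD : compact D.
  apply: bounded_closed_compact.
    by exists d; split=> [|M dM v [_ vd]]; [exact: num_real|exact: le_trans vd (ltW dM)].
  have -> : D = (fun v => v *m P - v) @^-1` [set 0] `&`
      (fun v : 'rV_n => `|v|) @^-1` [set x | x <= d].
    by apply/seteqP; split=> v /= [vP vd]; split=> //; [rewrite vP subrr|exact/subr0_eq].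
  apply: closedI.
    apply: closed_comp.
      move=> v _; apply: (@continuousB _ _ _ (mulmxr P) id).
        exact: mulmx_continuous.
      exact: cvg_id.
    by apply: compact_closed; [exact: norm_hausdorff|exact: compact_set1].
  apply: closed_comp; last exact: closed_le.
  by move=> v _; exact: norm_continuous.
have [||w Dw] := @compact_contraction_fixpoint D T cD _ DT.
- by exists 0; split; rewrite ?mul0mx ?normr0.
- move=> v w Dv Dw; apply: le_trans (Tc _ _ Dv Dw) _.
  by rewrite ler_wpM2r // lef_pV2 ?posrE // ler_nat.
rewrite /T => /eqP; rewrite addrC -subr_eq0 addrK => /eqP /(congr1 (mulmxr A)) /=.
rewrite -mulmxA BA mulmx1 mul0mx => /subr0_eq w'E.
have [Gw gw] := gP _ Dw.1 Dw.2.
by exists (F (g w)) => //; exists (g w) => //; split; rewrite // -w'E.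
Qed.

End GraphTransform.

(** * Uniform estimates in charts *)

Section NearUniform.
Variables (R : realType) (M : topologicalType).

(** The closed sets [V i] stand for pieces of charts: near a point outside [V i] the claim is
    vacuous, near one inside it is the local estimate, and compactness of [K] extracts a common
    radius. *)
Lemma near_uniform (I : finType) (V : I -> set M) (K : set M)
    (P : I -> R -> M -> Prop) : compact K -> (forall i, closed (V i)) ->
  (forall i x, K x -> V i x ->
    \forall y \near x & r \near 0^'+, K y -> V i y -> P i r y) ->
  \forall r \near 0^'+, forall i y, K y -> V i y -> P i r y.
Proof.
move=> cK cV loc.
have /(_ R (0^'+)%R (fun r y => K y -> forall i, V i y -> P i r y)) :=
  (compact_near_coveringP K).1 cK.
case=> [x Kx|e e0 He]; last by exists e => // r re r0 i y Ky; exact: (He r re r0 y Ky).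
have h i : \forall z \near (nbhs x, (0 : R)^'+), K z.1 -> V i z.1 -> P i z.2 z.1.
  have [Vx|Vx] := pselect (V i x); first exact: loc.
  exists (~` V i, setT) => [|[y r] /= [nV _] _ //].
  split; last exact: filterT.
  by apply: open_nbhs_nbhs; split=> //; exact: closed_openC.
have FF : Filter (filter_prod (nbhs x) (0 : R)^'+) by exact: filter_prod_filter.
have {}h := @filter_forall _ I _ _ FF h.
by apply: (@filterS _ _ FF _ _ _ h) => -[y r] /= {}h Ky i Vy; exact: h.
Qed.

End NearUniform.

Lemma compact_finite_subcover (M : topologicalType) (K : set M) (W : M -> set M) :
  compact K -> (forall x, K x -> nbhs x (W x)) ->
  exists s : seq M, forall y, K y -> exists2 x, x \in s & K x /\ W x y.
Proof.
move=> cK WP.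
(* The filter of all large enough finite lists turns the near-covering form of compactness into a
   finite subcover with centres in [K]. *)
pose F := filter_from [set: seq M] (fun t => [set s | {subset t <= (s : seq M)}]).
have FF : Filter F.
  apply: filter_from_filter; first by exists [::].
  move=> s t _ _; exists (s ++ t) => // u stu.
  by split=> x xs; apply: stu; rewrite mem_cat xs ?orbT.
have := (compact_near_coveringP _).1 cK _ F
  (fun s y => exists2 x, x \in s & K x /\ W x y) FF.
case=> [x Kx|D _ /(_ D) DM]; last by exists D; apply: DM.
exists (W x, [set s | x \in (s : seq M)]) => [|[y s] /= [Wy xs]]; last by exists x.
split=> /=; first exact: WP.
by exists [:: x] => // s /= h; apply: h; rewrite inE.
Qed.

Section ChartCalculus.
Variables (R : realType) (n : nat) (M : topologicalType).
Implicit Types (c d e : chart R n M) (phi psi : M -> M) (x y : M).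

Lemma chart_dom_nbhs c y : chart_dom c y -> nbhs y (chart_dom c).
Proof. by move=> cy; apply: open_nbhs_nbhs; split=> //; exact: chart_dom_open. Qed.

Lemma chart_cont c y : chart_dom c y -> {for y, continuous c}.
Proof. by move=> cy; apply: chart_continuous; rewrite inE. Qed.

Lemma chart_inv_cont c v : (c @` chart_dom c) v -> {for v, continuous (chart_inv c)}.
Proof. by move=> cv; apply: chart_inv_continuous; rewrite inE. Qed.

Lemma chartK_in c y : chart_dom c y -> chart_inv c (c y) = y.
Proof. by move=> cy; apply: chartK; rewrite inE. Qed.

Lemma chart_invK c v : (c @` chart_dom c) v ->
  chart_dom c (chart_inv c v) /\ c (chart_inv c v) = v.
Proof. by move=> [y cy <-]; rewrite chartK_in. Qed.

Lemma chart_near c (O : set M) y : chart_dom c y -> nbhs y O ->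
  \forall v \near c y, (c @` chart_dom c) v /\ O (chart_inv c v).
Proof.
move=> cy Oy; apply: filterI.
  by apply: open_nbhs_nbhs; split; [exact: chart_img_open|exists y].
have cc : {for c y, continuous (chart_inv c)} by apply: chart_inv_cont; exists y.
by apply: cc; rewrite chartK_in.
Qed.

Lemma chart_image_open c (O : set M) : open O -> O `<=` chart_dom c -> open (c @` O).
Proof.
move=> oO Oc; rewrite openE => _ [y Oy <-].
have Oy' : nbhs y O by apply: open_nbhs_nbhs.
apply: filterS (chart_near (Oc _ Oy) Oy') => v [cv Ov].
by exists (chart_inv c v); rewrite // (chart_invK cv).2.
Qed.

(** Continuity of [phi] is required because charts are meaningless off their domains: in a
    composition the middle chart must cancel on a whole neighborhood of [y]. *)
Definition csdiff phi c d y (A : 'M[R]_n) : Prop :=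
  [/\ chart_dom c y, chart_dom d (phi y), {for y, continuous phi} &
      sdiff (d \o phi \o chart_inv c) (c y) A].

Definition chart_diff phi c d y : 'M[R]_n := 'J (d \o phi \o chart_inv c) (c y).

Lemma csdiff_diff phi c d y A : csdiff phi c d y A -> chart_diff phi c d y = A.
Proof. by move=> [_ _ _ /sdiff_jacobian]. Qed.

Lemma csdiff_comp phi psi c d e y A B :
  csdiff phi c d y A -> csdiff psi d e (phi y) B ->
  csdiff (psi \o phi) c e y (A *m B).
Proof.
move=> [cy dphi cphi dF] [_ epsi cpsi dG]; split=> //; first exact: continuous_comp.
have FE : (d \o phi \o chart_inv c) (c y) = d (phi y) by rewrite /= chartK_in.
rewrite -FE in dG; apply: sdiff_eq (sdiff_comp dF dG).
have : nbhs y (phi @^-1` chart_dom d) by apply: cphi; exact: chart_dom_nbhs.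
move=> /(chart_near cy); apply: filterS => v [_ dv] /=.
by rewrite chartK_in.
Qed.

Lemma csdiff_id_refl c y : chart_dom c y -> csdiff id c c y 1%:M.
Proof.
move=> cy; split=> //; apply: sdiff_eq (sdiff_id _).
apply: filterS (chart_near cy (chart_dom_nbhs cy)) => v [cv _] /=.
by rewrite (chart_invK cv).2.
Qed.

Variable S : smooth_structure R n M.

Definition chart_smooth phi : Prop := continuous phi /\ forall a b y,
  chart_dom (S a) y -> chart_dom (S b) (phi y) ->
  csdiff phi (S a) (S b) y (chart_diff phi (S a) (S b) y).

Lemma chart_smooth_comp phi psi :
  chart_smooth phi -> chart_smooth psi -> chart_smooth (psi \o phi).
Proof.
move=> [cphi sphi] [cpsi spsi]; split=> [|a b y ay by'].
  by move=> y; apply: continuous_comp; [exact: cphi|exact: cpsi].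
have := csdiff_comp (sphi a (phi y) y ay (chart_at_dom S _))
  (spsi (phi y) b _ (chart_at_dom S _) by').
by move=> h; rewrite (csdiff_diff h).
Qed.

Lemma chart_diff_comp phi psi (a b e y : M) : chart_smooth phi -> chart_smooth psi ->
  chart_dom (S a) y -> chart_dom (S e) (phi y) -> chart_dom (S b) (psi (phi y)) ->
  chart_diff (psi \o phi) (S a) (S b) y =
    chart_diff phi (S a) (S e) y *m chart_diff psi (S e) (S b) (phi y).
Proof.
move=> [_ sphi] [_ spsi] ay ey by'; apply: csdiff_diff.
exact: csdiff_comp (sphi _ _ _ ay ey) (spsi _ _ _ ey by').
Qed.

Lemma chart_diff_id_refl a y : chart_dom (S a) y ->
  chart_diff id (S a) (S a) y = 1%:M.
Proof. by move=> ay; apply: csdiff_diff; exact: csdiff_id_refl. Qed.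

Lemma Ck_map1_chart_smooth phi : Ck_map S 1 phi -> chart_smooth phi.
Proof.
move=> [cphi sphi]; split=> // a b y ay by'; split=> //; first exact: cphi.
apply: (@Ck1_sdiff _ _ _ (S a @` (chart_dom (S a) `&` phi @^-1` chart_dom (S b)))).
- apply: chart_image_open => [|? []//]; apply: openI; first exact: chart_dom_open.
  by apply: open_comp; [move=> ? _; exact: cphi|exact: chart_dom_open].
- by exists y.
- exact: sphi.
Qed.

Lemma id_chart_smooth : chart_smooth id.
Proof.
split=> [y|a b y ay by']; first exact: cvg_id.
split=> //.
apply: (@Ck1_sdiff _ _ _ (S a @` (chart_dom (S a) `&` chart_dom (S b)))).
- by apply: chart_image_open => [|? []//]; apply: openI; exact: chart_dom_open.
- by exists y.
- exact: (chart_at_smooth S a b 1%N).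
Qed.

Lemma iter_chart_smooth phi k : chart_smooth phi -> chart_smooth (iter k phi).
Proof.
move=> sphi; elim: k => [|k IH]; first exact: id_chart_smooth.
exact: (chart_smooth_comp IH sphi).
Qed.

Lemma chart_diff_inverse phi psi a b y : chart_smooth phi -> chart_smooth psi ->
  cancel phi psi -> chart_dom (S a) y -> chart_dom (S b) (phi y) ->
  chart_diff phi (S a) (S b) y *m chart_diff psi (S b) (S a) (phi y) = 1%:M.
Proof.
move=> sphi spsi phiK ay by'; rewrite -chart_diff_comp ?phiK //.
have -> : psi \o phi = id by apply/funext => z; exact: phiK.
exact: chart_diff_id_refl.
Qed.

Lemma chart_jacK a b y : chart_dom (S a) y -> chart_dom (S b) y ->
  chart_jac (S a) (S b) y *m chart_jac (S b) (S a) y = 1%:M.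
Proof.
by move=> ay by'; apply: (@chart_diff_inverse id id); rewrite //; exact: id_chart_smooth.
Qed.

Lemma tangent_map_comp phi psi x : chart_smooth phi -> chart_smooth psi ->
  tangent_map S (psi \o phi) x = tangent_map S phi x *m tangent_map S psi (phi x).
Proof.
by move=> sphi spsi; apply: chart_diff_comp => //; exact: chart_at_dom.
Qed.

Lemma tangent_map_id x : tangent_map S id x = 1%:M.
Proof. by apply: chart_diff_id_refl; exact: chart_at_dom. Qed.

Lemma chart_diffE phi a b x : chart_smooth phi ->
  chart_dom (S a) x -> chart_dom (S b) (phi x) ->
  chart_diff phi (S a) (S b) x =
  chart_jac (S a) (S x) x *m tangent_map S phi x *m chart_jac (S (phi x)) (S b) (phi x).
Proof.
move=> sphi ax bx.
have := @chart_diff_comp id phi a (phi x) x x id_chart_smooth sphi ax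
  (chart_at_dom S _) (chart_at_dom S _).
rewrite -/(tangent_map S phi x) => <-.
exact: (@chart_diff_comp phi id a b (phi x) x sphi id_chart_smooth ax
  (chart_at_dom S _) bx).
Qed.

(** A compact Hausdorff space is regular, so chart domains can be shrunk to closed neighborhoods
    before a finite subcover is taken. Closedness is what [near_uniform] asks for. *)
Lemma finite_charts : hausdorff_space M -> compact [set: M] ->
  exists (I : finType) (q : I -> M) (V : I -> set M) (idx : M -> I),
  [/\ forall i, closed (V i), forall i, V i `<=` chart_dom (S (q i)) &
      forall y, V (idx y) y].
Proof.
move=> hM cM.
have W x : exists W : set M, nbhs x W /\ closure W `<=` chart_dom (S x).
  have [W Wx WS] := compact_regular hM cM (@filterT _ _ (nbhs_filter x))
    (chart_dom_nbhs (chart_at_dom S x)).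
  by exists W.
have [{}W WP] := choice W.
have [x _|D DM] := @compact_finite_subcover M setT (fun x => (W x)°) cM.
  by apply: open_nbhs_nbhs; split; [exact: open_interior|exact: (WP x).1].
pose q i := tnth (in_tuple D) i.
have idxP y : exists i, (W (q i))° y.
  by have [x /(tnthP (in_tuple D))[i ->] [_ ?]] := DM y I; exists i.
have [idx {}idxP] := choice idxP.
exists 'I_(size D), q, (fun i => closure (W (q i))), idx; split=> [i|i|y].
- exact: closed_closure.
- exact: (WP _).2.
- by apply: subset_closure; apply: interior_subset; exact: idxP.
Qed.

End ChartCalculus.

(** * Estimates near one point, in fixed charts *)

Section LocalEstimates.
Variables (R : realType) (n : nat) (M : topologicalType).
Implicit Types (c : chart R n M) (phi psi : M -> M) (x y : M).

Lemma near_chart_ball c (O : set M) x e : chart_dom c x -> nbhs x O -> 0 < e ->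
  \forall y \near x & r \near (0 : R)^'+,
    [/\ chart_dom c y, O y, `|c y - c x| < e & 0 < r < e].
Proof.
move=> cx Ox e0.
have cc := chart_cont cx.
exists (chart_dom c `&` O `&` [set y | `|c y - c x| < e], [set r | 0 < r < e]).
  split=> /=.
    apply: filterI; first by apply: filterI; [exact: chart_dom_nbhs|].
    by have := (@cvgrPdistC_lt _ _ _ _ (nbhs_filter x) _ _).1 cc e e0.
  near=> r; apply/andP; split; near: r.
    exact: nbhs_right_gt.
  exact: nbhs_right_lt.
by move=> [y r] /= [[[cy Oy] ye] re].
Unshelve. all: by end_near. Qed.

Lemma chart_control c (O : set M) x : chart_dom c x -> nbhs x O ->
  \forall y \near x & r \near (0 : R)^'+, forall v, `|v| <= r ->
    (c @` chart_dom c) (c y + v) /\ O (chart_inv c (c y + v)).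
Proof.
move=> cx /(chart_near cx) /nbhs_ballP[e /= e0 eP].
have e20 : 0 < e / 2 by rewrite divr_gt0.
apply: filterS (near_chart_ball cx (@filterT _ _ (nbhs_filter x)) e20).
move=> [y r] /= [cy _ ye /andP[r0 re]] v vr.
apply: eP; rewrite -ball_normE /= opprD addrA (splitr e).
by rewrite (le_lt_trans (ler_normB _ _)) // ltrD // ?(le_lt_trans vr) // distrC.
Qed.

Variable S : smooth_structure R n M.

(** The small factor [r] on the left replaces a large constant on the right, so that the bound holds
    for all small [r] and [near_uniform] applies. *)
Lemma chart_diff_bound phi a b x : chart_smooth S phi ->
  chart_dom (S a) x -> chart_dom (S b) (phi x) ->
  \forall y \near x & r \near (0 : R)^'+,
    forall v : 'rV_n, r * `|v *m chart_diff phi (S a) (S b) y| <= `|v|.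
Proof.
move=> [cphi sphi] ax bx; have [_ _ _ dF] := sphi a b x ax bx.
have [d d0 dP] := sdiff_near dF ltr01.
set A := chart_diff _ _ _ x in dF dP.
set L := 1 + n%:R * `|A|.
have L0 : 0 < L by rewrite ltr_pwDl // mulr_ge0.
have m0 : 0 < Num.min d L^-1 by rewrite lt_min d0 invr_gt0.
have bO : nbhs x (phi @^-1` chart_dom (S b)) by apply: cphi; exact: chart_dom_nbhs.
apply: filterS (near_chart_ball ax bO m0) => -[y r] /= [ay by' ye /andP[r0 re]] v.
move: ye re; rewrite !lt_min => /andP[ye _] /andP[_ rL].
have [_ _ _ dFy] := sphi a b y ay by'.
have := dP _ _ ye dFy v; rewrite mulmxBr mul1r => h.
have : `|v *m chart_diff phi (S a) (S b) y| <= L * `|v|.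
  rewrite -[v *m chart_diff _ _ _ y](subrK (v *m A)) (le_trans (ler_normD _ _)) //.
  by rewrite mulrDl mul1r lerD // norm_mulmx.
move=> /(ler_wpM2l (ltW r0)) /le_trans; apply.
by rewrite mulrA ler_piMl // -ler_pdivlMr // mul1r ltW.
Qed.

(** Half of [eta] pays for replacing [phi] by its differential at [x], the other half for moving
    that differential from [x] to [y]. *)
Lemma chart_diff_approx phi a b x eta : 0 < eta -> chart_smooth S phi ->
  chart_dom (S a) x -> chart_dom (S b) (phi x) ->
  \forall y \near x & r \near (0 : R)^'+, forall v w, `|v| <= r -> `|w| <= r ->
    `|S b (phi (chart_inv (S a) (S a y + v))) - S b (phi (chart_inv (S a) (S a y + w)))
      - (v - w) *m chart_diff phi (S a) (S b) y| <= eta * `|v - w|.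
Proof.
move=> eta0 [cphi sphi] ax bx; have [_ _ _ dF] := sphi a b x ax bx.
have eta20 : 0 < eta / 2 by rewrite divr_gt0.
have [d d0 dP] := sdiff_near dF eta20.
have [e e0 eP] := dF _ eta20.
set A := chart_diff _ _ _ x in dF dP eP.
have m0 : 0 < Num.min d (e / 2) by rewrite lt_min d0 divr_gt0.
have bO : nbhs x (phi @^-1` chart_dom (S b)) by apply: cphi; exact: chart_dom_nbhs.
apply: filterS (near_chart_ball ax bO m0) => -[y r] /= [ay by' ye /andP[r0 re]] v w vr wr.
move: ye re; rewrite !lt_min => /andP[yd ye] /andP[_ re].
have [_ _ _ dFy] := sphi a b y ay by'.
have h := dP _ _ yd dFy (v - w).
have eb u : `|u| <= r -> `|S a y + u - S a x| < e.
  move=> ur; rewrite addrAC (le_lt_trans (ler_normD _ _)) // (splitr e) ltrD //.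
  exact: le_lt_trans re.
have h2 := eP _ _ (eb _ vr) (eb _ wr).
rewrite /= (_ : S a y + v - (S a y + w) = v - w) in h2; last first.
  by rewrite opprD addrACA subrr add0r.
set X := S b _ - S b _ in h2 *.
set B := chart_diff _ _ _ y in h *.
have -> : X - (v - w) *m B = (X - (v - w) *m A) - (v - w) *m (B - A).
  by rewrite mulmxBr opprB addrA subrK.
rewrite (le_trans (ler_normB _ _)) // (splitr eta) mulrDl lerD //.
Qed.

Lemma norm_trmx (v : 'rV[R]_n) : `|v^T| = `|v|.
Proof.
rewrite [LHS](_ : _ = mx_norm v^T) // [RHS](_ : _ = mx_norm v) // !mx_normrE.
apply/le_anti/andP; split; apply/bigmax_leP; split=> [|[i j] _] /=.
- exact: bigmax_ge_id.
- rewrite mxE; exact: (le_bigmax _ (fun ij : 'I_1 * 'I_n => `|v ij.1 ij.2|) (j, i)).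
- exact: bigmax_ge_id.
- have := le_bigmax 0 (fun ij : 'I_n * 'I_1 => `|v^T ij.1 ij.2|) (j, i).
  by rewrite /= mxE.
Qed.

Lemma norm_quadratic (v : 'rV[R]_n) (A : 'M[R]_n) :
  `|(v *m A *m v^T) 0 0| <= n%:R * (n%:R * `|A|) * `|v| ^+ 2.
Proof.
apply: le_trans (coord_le_norm _ _) _; apply: le_trans (norm_mulmx _ _) _.
rewrite norm_trmx; have := norm_mulmx v A; have := ler0n R n.
have -> : n%:R * (n%:R * `|A|) * `|v| ^+ 2 = n%:R * `|v| * (n%:R * `|A| * `|v|) by ring.
by move=> ? ?; rewrite ler_wpM2l // mulr_ge0.
Qed.

Lemma quadratic_lower_bound (A : 'M[R]_n) :
  (forall v : 'rV[R]_n, v != 0 -> 0 < (v *m A *m v^T) 0 0) ->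
  exists2 m, 0 < m & forall v : 'rV[R]_n, m * `|v| ^+ 2 <= (v *m A *m v^T) 0 0.
Proof.
move=> A_pos; pose Sph := [set v : 'rV[R]_n | `|v| = 1].
have scale (v : 'rV[R]_n) (k : R) :
    ((k *: v) *m A *m (k *: v)^T) 0 0 = k ^+ 2 * (v *m A *m v^T) 0 0.
  by rewrite [(k *: v)^T]linearZ /= -!scalemxAl -scalemxAr !mxE mulrA expr2.
have SphP (v : 'rV[R]_n) : v != 0 -> Sph (`|v|^-1 *: v).
  move=> v0; rewrite /Sph /= normrZ ger0_norm ?invr_ge0 // mulVf //.
  by rewrite normr_eq0.
(* The sphere is empty when [n = 0]. *)
have [[v0 Sv0]|empty] := pselect (Sph !=set0); last first.
  exists 1 => // v; have [->|/SphP v0] := eqVneq v 0.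
    by rewrite normr0 expr0n mulr0 !mul0mx mxE.
  by case: empty; exists (`|v|^-1 *: v).
have cQ : {within Sph, continuous (fun v : 'rV[R]_n => (v *m A *m v^T) 0 0)}.
  apply: continuous_subspaceT => v.
  have cvA := @mulmx_continuous R n n A v.
  have -> : (fun v : 'rV[R]_n => (v *m A *m v^T) 0 0) =
      (fun v => \sum_j (v *m A) 0 j * v 0 j).
    by apply/funext => w; rewrite mxE; apply: eq_bigr => j _; rewrite [w^T _ _]mxE.
  elim: (index_enum _) => [|j s IH].
    rewrite (_ : (fun _ => _) = (fun=> 0 : R)); first exact: (@cst_continuous _ _ (0 : R) v).
    by apply/funext => w; rewrite big_nil.
  rewrite (_ : (fun _ => _) = (fun w : 'rV[R]_n => (w *m A) 0 j * w 0 j) \+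
      (fun w => \sum_(k <- s) (w *m A) 0 k * w 0 k)); last first.
    by apply/funext => w; rewrite big_cons.
  apply: continuousD; last exact: IH.
  apply: (@continuousM _ _ (fun w : 'rV[R]_n => (w *m A) 0 j) (fun w : 'rV[R]_n => w 0 j)).
    exact: (@continuous_coord _ _ _ (mulmxr A)).
  exact: coord_continuous.
have cS : compact Sph.
  apply: bounded_closed_compact.
    exists 1; split=> [|m m1 v Sv /=]; first exact: num_real.
    by rewrite (_ : `|v| = 1) ?ltW.
  rewrite (_ : Sph = (fun v : 'rV[R]_n => `|v|) @^-1` [set 1]) //.
  apply: closed_comp; first by move=> v _; exact: norm_continuous.
  by apply: compact_closed; [exact: norm_hausdorff|exact: compact_set1].
have [u] := compact_EVT_min (ex_intro _ v0 Sv0) cS cQ.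
rewrite inE => Su umin.
have u0 : u != 0.
  by apply: contraPneq Su => ->; rewrite /Sph /= normr0 => /eqP; rewrite eq_sym oner_eq0.
exists ((u *m A *m u^T) 0 0); first exact: A_pos.
move=> v; have [->|v_neq0] := eqVneq v 0.
  by rewrite normr0 expr0n mulr0 !mul0mx mxE.
have /umin : `|v|^-1 *: v \in Sph by rewrite inE; exact: SphP.
by rewrite scale exprVn mulrC ler_pdivlMr // exprn_gt0 // normr_gt0.
Qed.

Lemma tangent_norm_equiv g a x : riemannian_metric S g -> chart_dom (S a) x ->
  \forall y \near x & r \near (0 : R)^'+, forall v : 'rV[R]_n,
    r * `|v| <= tangent_norm g y (v *m chart_jac (S a) (S y) y) /\
    r * tangent_norm g y (v *m chart_jac (S a) (S y) y) <= `|v|.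
Proof.
move=> [_ gpos gsmooth] ax.
pose G y := chart_jac (S a) (S y) y *m g y *m (chart_jac (S a) (S y) y)^T.
have tE y v : tangent_norm g y (v *m chart_jac (S a) (S y) y) =
    Num.sqrt ((v *m G y *m v^T) 0 0).
  by rewrite /tangent_norm /G trmx_mul !mulmxA.
have G_pos (v : 'rV[R]_n) : v != 0 -> 0 < (v *m G x *m v^T) 0 0.
  move=> v0; have /(gpos x) : v *m chart_jac (S a) (S x) x != 0.
    apply: contra v0 => /eqP /(congr1 (mulmxr (chart_jac (S x) (S a) x))) /=.
    by rewrite -mulmxA chart_jacK ?mulmx1 ?mul0mx => [->||//]; last exact: chart_at_dom.
  by rewrite /G trmx_mul !mulmxA.
have [m m0 mP] := quadratic_lower_bound G_pos.
have cG : {for x, continuous G}.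
  have /(_ (S a x)) := gsmooth a 0%N; rewrite inE => /(_ _)/wrap[|cG]; first by exists x.
  have : {for x, continuous ((G \o chart_inv (S a)) \o S a)}.
    by apply: continuous_comp; [exact: chart_cont|exact: cG].
  have E : {near x, (G \o chart_inv (S a)) \o S a =1 G}.
    by apply: filterS (chart_dom_nbhs ax) => y ay /=; rewrite chartK_in.
  move=> /(cvg_trans (near_eq_cvg E)) cG'.
  have Gx : ((G \o chart_inv (S a)) \o S a) x = G x by rewrite /= chartK_in.
  by rewrite Gx in cG'.
(* Near [x] the Gram matrix varies by at most 1, which gives the upper bound [L], and its quadratic
   form loses at most half of the lower bound [m]. Taking [r <= 1] gives [r ^+ 2 <= r], so that
   squared norms can be compared. *)
set L := n%:R * (n%:R * (`|G x| + 1)) + 1.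
have L0 : 0 < L by rewrite ltr_wpDl // !mulr_ge0 // addr_ge0.
pose e := Num.min 1 (m / 2 / (n%:R * n%:R + 1)).
have e0 : 0 < e by rewrite lt_min ltr01 !divr_gt0 // ltr_wpDl // mulr_ge0.
have Oe := (@cvgrPdistC_lt _ _ _ _ (nbhs_filter x) _ _).1 cG e e0.
have r10 : 0 < Num.min 1 (Num.min (m / 2) L^-1) by rewrite !lt_min ltr01 divr_gt0 ?invr_gt0.
apply: filterS (near_chart_ball ax Oe r10) => -[y r] /= [ay ye _ /andP[r0 re]] v.
move: re; rewrite !lt_min => /and3P[r1 rm rL].
have r2r : r ^+ 2 <= r by rewrite expr2 ler_piMl ?ltW.
have QE (X Y : 'M[R]_n) : (v *m Y *m v^T) 0 0 =
    (v *m X *m v^T) 0 0 + (v *m (Y - X) *m v^T) 0 0.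
  by rewrite -{1}(subrK X Y) mulmxDr mulmxDl [LHS]mxE addrC.
have v20 : 0 <= `|v| ^+ 2 by rewrite sqr_ge0.
have low : m / 2 * `|v| ^+ 2 <= (v *m G y *m v^T) 0 0.
  rewrite (QE (G x)); have h1 := mP v.
  have : `|(v *m (G y - G x) *m v^T) 0 0| <= m / 2 * `|v| ^+ 2.
    apply: le_trans (norm_quadratic _ _) _; rewrite ler_wpM2r //.
    have : `|G y - G x| <= m / 2 / (n%:R * n%:R + 1).
      by rewrite ltW // (lt_le_trans ye) // ge_min lexx orbT.
    rewrite ler_pdivlMr ?ltr_wpDl ?mulr_ge0 // => h.
    apply: le_trans h; rewrite mulrA mulrC ler_wpM2l // lerDl //.
  rewrite ler_norml => /andP[h2 _]; move: h1 h2; lra.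
have up : (v *m G y *m v^T) 0 0 <= L * `|v| ^+ 2.
  apply: le_trans (ler_norm _) _; apply: le_trans (norm_quadratic _ _) _.
  rewrite ler_wpM2r // -[leLHS]addr0 lerD // !ler_wpM2l //.
  rewrite -[G y](subrK (G x)) (le_trans (ler_normD _ _)) // addrC lerD2l.
  by rewrite ltW // (lt_le_trans ye) // ge_min lexx.
have Q0 : 0 <= (v *m G y *m v^T) 0 0.
  by apply: le_trans low; rewrite mulr_ge0 // ltW // divr_gt0.
rewrite tE; split; rewrite -(@ler_pXn2r _ 2) ?nnegrE ?mulr_ge0 ?sqrtr_ge0 ?(ltW r0) //.
  rewrite exprMn sqr_sqrtr //; apply: le_trans low; rewrite ler_wpM2r //.
  by rewrite (le_trans r2r) // ltW.
rewrite exprMn sqr_sqrtr //; apply: (@le_trans _ _ (r * (L * `|v| ^+ 2))).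
  by apply: le_trans (ler_wpM2r Q0 r2r) _; rewrite ler_wpM2l // ltW.
by rewrite mulrA ler_piMl // -ler_pdivlMr // mul1r ltW.
Qed.

End LocalEstimates.

(** * Hyperbolic splittings in charts *)

Section SplittingProjection.
Variables (F : fieldType) (n : nat) (U V : 'M[F]_n).
Hypothesis UV_full : (V + U == 1%:M)%MS.
Hypothesis UV_cap : (V :&: U == (0 : 'M[F]_n))%MS.

Lemma splitting_cap : (U :&: V = 0)%MS.
Proof.
by apply/eqP; rewrite -submx0 capmxC; have /andP[] := UV_cap.
Qed.

Lemma splitting_sub m (w : 'M[F]_(m, n)) : (w <= U + V)%MS.
Proof.
have /andP[_ h] := UV_full; apply: submx_trans (submx1 w) _.
by rewrite addsmxC.
Qed.

Lemma splitting_proj_compl m (w : 'M[F]_(m, n)) : (w - w *m proj_mx U V <= V)%MS.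
Proof.
rewrite -{1}(add_proj_mx splitting_cap (splitting_sub w)) addrC addKr.
exact: proj_mx_sub.
Qed.

Lemma splitting_proj_idem : proj_mx U V *m proj_mx U V = proj_mx U V.
Proof. exact: (proj_mx_proj splitting_cap). Qed.

Lemma splitting_proj_rank : \rank (proj_mx U V) = \rank U.
Proof.
apply/eqP; rewrite eqn_leq; apply/andP; split; apply: mxrankS.
  by rewrite -[proj_mx U V]mul1mx; exact: proj_mx_sub.
by rewrite -{1}(proj_mx_id splitting_cap (submx_refl U)) submxMl.
Qed.

End SplittingProjection.

Lemma splitting_proj_comm (F : fieldType) n (U V U' V' T : 'M[F]_n) :
  (V + U == 1%:M)%MS -> (V :&: U == (0 : 'M[F]_n))%MS ->
  (V' + U' == 1%:M)%MS -> (V' :&: U' == (0 : 'M[F]_n))%MS ->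
  (U *m T <= U')%MS -> (V *m T <= V')%MS ->
  proj_mx U V *m T = T *m proj_mx U' V'.
Proof.
move=> UV1 UV0 UV1' UV0' UT VT.
have -> : T *m proj_mx U' V' = (1%:M - proj_mx U V) *m T *m proj_mx U' V' +
    proj_mx U V *m T *m proj_mx U' V' by rewrite -!mulmxDl subrK mul1mx.
rewrite (proj_mx_0 (splitting_cap UV0')) ?add0r; last first.
  apply: submx_trans VT; apply: submxMr.
  by rewrite -[proj_mx U V]mul1mx; exact: splitting_proj_compl.
rewrite (proj_mx_id (splitting_cap UV0')) //.
apply: submx_trans UT; apply: submxMr.
by rewrite -[proj_mx U V]mul1mx; exact: proj_mx_sub.
Qed.

Section HyperbolicIterates.
Variables (R : realType) (n : nat) (M : topologicalType).
Variables (S : smooth_structure R n M) (f : diffeomorphism S).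

Lemma diffeo_smooth : chart_smooth S f.
Proof. exact/Ck_map1_chart_smooth/diffeo_C1. Qed.

Lemma diffeo_inv_smooth : chart_smooth S (diffeo_inv f).
Proof. exact/Ck_map1_chart_smooth/diffeo_inv_C1. Qed.

Lemma iter_diffeoK k : cancel (iter k f) (iter k (diffeo_inv f)).
Proof.
by elim: k => // k IH x; rewrite iterSr [iter k.+1 f x]iterS diffeoK IH.
Qed.

Lemma iter_diffeoVK k : cancel (iter k (diffeo_inv f)) (iter k f).
Proof.
by elim: k => // k IH x; rewrite iterSr [iter k.+1 (diffeo_inv f) x]iterS diffeoVK IH.
Qed.

Variables (L : set M) (Es Eu : M -> 'M[R]_n).
Hypothesis L_inv : invariant_set f L.
Hypothesis hyp : hyperbolic_splitting f L Es Eu.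

Lemma invariant_iter (K : set M) k x : invariant_set f K -> K x -> K (iter k f x).
Proof. by move=> Kf Kx; elim: k => //= k IH; rewrite -Kf; exists (iter k f x). Qed.

Lemma invariant_inv (K : set M) x : invariant_set f K -> K x -> K (diffeo_inv f x).
Proof. by move=> Kf; rewrite -{1}Kf => -[y Ky <-]; rewrite diffeoK. Qed.

Lemma splitting_iter k x : L x ->
  (Es x *m tangent_map S (iter k f) x == Es (iter k f x))%MS /\
  (Eu x *m tangent_map S (iter k f) x == Eu (iter k f x))%MS.
Proof.
move=> Lx; elim: k => [|k [IHs IHu]].
  by rewrite tangent_map_id !mulmx1 !submx_refl.
have -> : tangent_map S (iter k.+1 f) x =
    tangent_map S (iter k f) x *m tangent_map S f (iter k f x).
  by apply: (tangent_map_comp x (iter_chart_smooth k diffeo_smooth) diffeo_smooth).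
have [_ _ /(_ _ (invariant_iter k L_inv Lx)) [fs fu] _] := hyp.
rewrite !mulmxA; split; apply/eqmxP.
  by apply: eqmx_trans (eqmxMr _ (eqmxP IHs)) _; exact/eqmxP.
by apply: eqmx_trans (eqmxMr _ (eqmxP IHu)) _; exact/eqmxP.
Qed.

Lemma hyperbolic_rate : (0 < n)%N -> L !=set0 ->
  exists g, riemannian_metric S g /\ forall e : R, 0 < e ->
  exists N : nat, (0 < N)%N /\ forall x, L x ->
    (forall v : 'rV[R]_n, (v <= Es x)%MS ->
      tangent_norm g (iter N f x) (v *m tangent_map S (iter N f) x)
        <= e * tangent_norm g x v) /\
    (forall w : 'rV[R]_n, (w <= Eu x)%MS ->
      tangent_norm g (iter N (diffeo_inv f) x)
          (w *m tangent_map S (iter N (diffeo_inv f)) x)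
        <= e * tangent_norm g x w).
Proof.
move=> n0 [x0 Lx0].
have [_ /(_ _ Lx0) [/andP[_ full] _] _ [g [gR [C [lam [C0 lam1 hs hu]]]]]] := hyp.
have [_ gpos _] := gR.
exists g; split=> // e e0.
have tn0 x v : tangent_norm g x v <= 0 -> v = 0.
  move=> t0; apply/eqP; apply: contraLR isT => /(gpos x) v0; rewrite -sqrtr_gt0 in v0.
  by have := lt_le_trans v0 t0; rewrite ltxx.
(* The definition only gives [lam < 1]. A negative [lam] would, at [k = 1], kill both summands of
   the nonzero tangent space at [x0]. *)
have lam0 : 0 <= lam.
  rewrite leNgt; apply/negP => lam_lt0.
  have z (v : 'rV[R]_n) : 0 <= C * lam ^+ 1 * tangent_norm g x0 v -> v = 0.
    rewrite expr1 => t0; apply: (tn0 x0); move: t0.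
    by rewrite nmulr_rge0 // pmulr_rlt0.
  have Es0 (v : 'rV[R]_n) : (v <= Es x0)%MS -> v = 0.
    move=> /(hs _ _ 1%N Lx0) /(le_trans _) h; apply: z; apply: h; exact: sqrtr_ge0.
  have Eu0 (v : 'rV[R]_n) : (v <= Eu x0)%MS -> v = 0.
    move=> /(hu _ _ 1%N Lx0) /(le_trans _) h; apply: z; apply: h; exact: sqrtr_ge0.
  have v0 : (delta_mx 0 (Ordinal n0) : 'rV[R]_n) != 0.
    apply/eqP => /rowP /(_ (Ordinal n0)); rewrite !mxE !eqxx => /eqP.
    by rewrite oner_eq0.
  have /sub_addsmxP[[u w] /= uw] := submx_trans (submx1 (delta_mx 0 (Ordinal n0) : 'rV[R]_n)) full.
  move: v0; rewrite uw (Es0 (u *m Es x0)) ?submxMl // (Eu0 (w *m Eu x0)) ?submxMl //.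
  by rewrite addr0 eqxx.
have [N _ NP] : \forall N \near \oo, (0 < N)%N /\ `|0 - lam ^+ N| < e / C.
  apply: filterI; first exact: nbhs_infty_gt.
  have lamn1 : `|lam| < 1 by rewrite ger0_norm.
  by have /cvgrPdist_lt := cvg_expr lamn1; apply; rewrite divr_gt0.
have [N0] := NP N (leqnn N); rewrite sub0r normrN ger0_norm ?exprn_ge0 // => NC.
have Ce : C * lam ^+ N <= e by rewrite mulrC -ler_pdivlMr // ltW.
exists N; split=> // x Lx; split=> v vE.
  by apply: le_trans (hs _ _ N Lx vE) _; rewrite ler_wpM2r // sqrtr_ge0.
by apply: le_trans (hu _ _ N Lx vE) _; rewrite ler_wpM2r // sqrtr_ge0.
Qed.

End HyperbolicIterates.

(* Hides the body of F, which conversion would otherwise unfold. *)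
Lemma abstract_fun (T T' : Type) (F : T -> T') : exists G, forall y, G y = F y.
Proof. by exists F. Qed.

Lemma conj_mulmx (F : fieldType) n (J1 X J2' J2 Y J3' : 'M[F]_n) :
  J2' *m J2 = 1%:M ->
  (J1 *m X *m J2') *m (J2 *m Y *m J3') = J1 *m (X *m Y) *m J3'.
Proof.
move=> JJ; rewrite -!mulmxA; congr (_ *m (_ *m _)).
by rewrite !mulmxA JJ mul1mx.
Qed.

Section HyperbolicCharts.
Variables (R : realType) (n : nat) (M : topologicalType).
Variables (S : smooth_structure R n M) (f : diffeomorphism S).
Variables (L B U : set M) (Es Eu : M -> 'M[R]_n).
Hypotheses (n_gt0 : (0 < n)%N) (M_hausdorff : hausdorff_space M).
Hypothesis M_compact : compact [set: M].
Hypotheses (L_inv : invariant_set f L) (hyp : hyperbolic_splitting f L Es Eu).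
Hypotheses (B_closed : closed B) (B_inv : invariant_set f B) (BL : B `<=` L).
Hypotheses (B_neq0 : B !=set0) (U_open : open U) (BU : B `<=` U).

(* S (c y) is the chart used at y, recentred so that y has coordinates 0. *)
Definition chart_point (c : M -> M) y v := chart_inv (S (c y)) (S (c y) y + v).

Definition chart_map (c : M -> M) (h : M -> M) y v :=
  S (c (h y)) (h (chart_point c y v)) - S (c (h y)) (h y).

(** All the analytic input of the unstable disks: a single iterate, a single radius and a choice of
    charts for which the graph transform works at every point of [B]. The last clause will keep
    distinct points from sharing small chart balls. *)
Lemma hyperbolic_charts : exists (N : nat) (c : M -> M) (P : M -> 'M[R]_n) (d : R),
  let h := iter N f in
  [/\ (0 < N)%N /\ 0 < d, forall y, chart_dom (S (c y)) y,
      forall y, B y ->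
        [/\ P y *m P y = P y, \rank (P y) = \rank (Eu y) & forall v, `|v| <= 2 * d ->
          [/\ (S (c y) @` chart_dom (S (c y))) (S (c y) y + v),
              U (chart_point c y v) & chart_dom (S (c (h y))) (h (chart_point c y v))]],
      forall y G, B y -> graph_over (P y) d G ->
        graph_over (P (h y)) d (graph_image (P (h y)) (chart_map c h y) d G) /\
        forall v, G v -> 3 * `|v *m P y| <= `|chart_map c h y v *m P (h y)| &
      forall a b, a <> b -> \forall r \near 0^'+, forall y u v, B y ->
        `|u| <= r -> `|v| <= r -> chart_point c y u = a -> chart_point c y v = b -> False].
Proof.
have [I [q [V [idx [V_closed VS V_idx]]]]] := finite_charts S M_hausdorff M_compact.
pose c y := q (idx y).
have cS y : chart_dom (S (c y)) y by apply: VS.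
have B_compact : compact B by apply: subclosed_compact B_closed M_compact _.
have L_neq0 : L !=set0 by have [x Bx] := B_neq0; exists x; exact: BL.
have [g [gR rate]] := hyperbolic_rate hyp n_gt0 L_neq0.
have fsm := diffeo_smooth f; have fism := diffeo_inv_smooth f.
have [r0 [r0_gt0 r0P]] : exists r0, 0 < r0 /\ forall y (v : 'rV[R]_n),
    r0 * `|v| <= tangent_norm g y (v *m chart_jac (S (c y)) (S y) y) /\
    r0 * tangent_norm g y (v *m chart_jac (S (c y)) (S y) y) <= `|v|.
  have := @near_uniform R M I V setT (fun i r y => forall v : 'rV[R]_n,
    r * `|v| <= tangent_norm g y (v *m chart_jac (S (q i)) (S y) y) /\
    r * tangent_norm g y (v *m chart_jac (S (q i)) (S y) y) <= `|v|) M_compact V_closed.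
  case=> [i x _ Vx|e e0 eP].
    have := tangent_norm_equiv gR (VS _ _ Vx).
    by apply: filterS => -[y r] /= h _ _.
  exists (e / 2); split=> [|y v]; first by rewrite divr_gt0.
  apply: (eP (e / 2) _ _ (idx y)) => //; last by rewrite divr_gt0.
  by rewrite /= sub0r normrN gtr0_norm ?divr_gt0 // ltr_pdivrMr // ltr_pMr // ltr1n.
(* Passing between chart norm and Riemannian norm costs a factor [r0] at each end of [h], so this
   rate in the metric becomes 1/4 in charts. *)
have r04 : 0 < r0 ^+ 2 / 4 by rewrite divr_gt0 // exprn_gt0.
have [N [N0 NP]] := rate _ r04.
pose h := iter N f; pose hi := iter N (diffeo_inv f).
have hK : cancel h hi by exact: iter_diffeoK.
have hiK : cancel hi h by exact: iter_diffeoVK.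
have hsm : chart_smooth S h by exact: iter_chart_smooth.
have hism : chart_smooth S hi by exact: iter_chart_smooth.
have hB y : B y -> B (h y) by exact: invariant_iter.
have [J JE] : exists J, forall y, J y = chart_jac (S (c y)) (S y) y :=
  abstract_fun (fun y => chart_jac (S (c y)) (S y) y).
have [J' J'E] : exists J', forall y, J' y = chart_jac (S y) (S (c y)) y :=
  abstract_fun (fun y => chart_jac (S y) (S (c y)) y).
have [Pi PiE] : exists Pi, forall y, Pi y = proj_mx (Eu y) (Es y) :=
  abstract_fun (fun y => proj_mx (Eu y) (Es y)).
(* The projection to E^u along E^s, carried from the coordinates of [S y] to those of the selected
   chart. *)
have [P PE] : exists P, forall y, P y = J y *m Pi y *m J' y :=
  abstract_fun (fun y => J y *m Pi y *m J' y).
have [A AdE] : exists A, forall y, A y = chart_diff h (S (c y)) (S (c (h y))) y :=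
  abstract_fun (fun y => chart_diff h (S (c y)) (S (c (h y))) y).
have [Ai AidE] : exists Ai, forall y,
    Ai y = chart_diff hi (S (c (h y))) (S (c y)) (h y) :=
  abstract_fun (fun y => chart_diff hi (S (c (h y))) (S (c y)) (h y)).
have JJ' y : J y *m J' y = 1%:M.
  by rewrite JE J'E; apply: chart_jacK => //; exact: chart_at_dom.
have J'J y : J' y *m J y = 1%:M by exact: mulmx1C.
have AE y : A y = J y *m tangent_map S h y *m J' (h y).
  by rewrite AdE JE J'E; exact: chart_diffE.
have AiE y : Ai y = J (h y) *m tangent_map S hi (h y) *m J' y.
  by rewrite AidE chart_diffE ?hK // JE J'E.
have AAi y : A y *m Ai y = 1%:M.
  rewrite AdE AidE; exact: (@chart_diff_inverse _ _ _ S h hi (c y) (c (h y)) y hsm hism hK).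
have AiA y : Ai y *m A y = 1%:M by apply: mulmx1C; exact: AAi.
have [_ full inv _] := hyp.
have PP y : B y -> P y *m P y = P y.
  move=> /BL /full [f1 f2].
  rewrite PE conj_mulmx; last exact: J'J.
  by rewrite PiE (splitting_proj_idem f2).
have P_rank y : B y -> \rank (P y) = \rank (Eu y).
  move=> /BL /full [f1 f2]; rewrite -(splitting_proj_rank f2) -PiE.
  have Ju : J y \in unitmx := (mulmx1_unit (JJ' y)).1.
  have J'u : J' y \in unitmx := (mulmx1_unit (JJ' y)).2.
  rewrite PE mxrankMfree ?row_free_unit // -mxrank_tr trmx_mul mxrankMfree ?mxrank_tr //.
  by rewrite row_free_unit unitmx_tr.
have PA y : B y -> P y *m A y = A y *m P (h y).
  move=> By; have Ly := BL By; have Lhy := BL (hB _ By).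
  have [f1 f2] := full _ Ly; have [f1' f2'] := full _ Lhy.
  have [/andP[fs _] /andP[fu _]] := splitting_iter L_inv hyp N Ly.
  rewrite AE !PE !conj_mulmx; try exact: J'J.
  by rewrite !PiE (splitting_proj_comm f1 f2 f1' f2' fu fs).
have Ai_contr y (v : 'rV[R]_n) : B y -> v *m P (h y) = v -> `|v *m Ai y| <= 4^-1 * `|v|.
  move=> By vP; have Lhy := BL (hB _ By).
  have wE : (v *m J (h y) <= Eu (h y))%MS.
    by rewrite -{1}vP PE -!mulmxA J'J mulmx1 (mulmxA v) PiE; exact: proj_mx_sub.
  have [_ /(_ _ wE)] := NP _ Lhy; rewrite -/hi -/h hK => nh.
  have [h1 _] := r0P y (v *m Ai y); have [_ h2] := r0P (h y) v.
  rewrite -JE in h1; rewrite -JE in h2.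
  have E : v *m Ai y *m J y = v *m J (h y) *m tangent_map S hi (h y).
    by rewrite AiE -!mulmxA J'J mulmx1.
  rewrite E in h1.
  have h3 := ler_wpM2l (ltW r0_gt0) (le_trans h1 nh).
  have h4 : r0 * (r0 ^+ 2 / 4 * tangent_norm g (h y) (v *m J (h y))) <= r0 ^+ 2 / 4 * `|v|.
    by rewrite mulrCA ler_wpM2l // ltW.
  have := le_trans h3 h4; rewrite mulrA -expr2 -mulrA ler_pM2l ?exprn_gt0 //.
have A_contr y (v : 'rV[R]_n) : B y -> v *m P y = 0 -> `|v *m A y| <= 4^-1 * `|v|.
  move=> By vP; have Ly := BL By; have [f1 f2] := full _ Ly.
  have wE : (v *m J y <= Es y)%MS.
    have := splitting_proj_compl f1 f2 (v *m J y).
    have -> : v *m J y *m proj_mx (Eu y) (Es y) = v *m P y *m J y.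
      by rewrite PE -PiE -!mulmxA J'J mulmx1.
    by rewrite vP mul0mx subr0.
  have [/(_ _ wE) nh _] := NP _ Ly; rewrite -/h in nh.
  have [h1 _] := r0P (h y) (v *m A y); have [_ h2] := r0P y v.
  rewrite -JE in h2; rewrite -JE in h1.
  have E : v *m A y *m J (h y) = v *m J y *m tangent_map S h y.
    by rewrite AE -!mulmxA J'J mulmx1.
  rewrite E in h1.
  have h3 := ler_wpM2l (ltW r0_gt0) (le_trans h1 nh).
  have h4 : r0 * (r0 ^+ 2 / 4 * tangent_norm g y (v *m J y)) <= r0 ^+ 2 / 4 * `|v|.
    by rewrite mulrCA ler_wpM2l // ltW.
  have := le_trans h3 h4; rewrite mulrA -expr2 -mulrA ler_pM2l ?exprn_gt0 //.
(* Estimates on [h] involve two charts, one at [y] and one at [h y]. *)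
pose V2 (ij : I * I) := V ij.1 `&` h @^-1` V ij.2.
have V2_closed ij : closed (V2 ij).
  apply: closedI => //; apply: closed_comp => // y _; exact: hsm.1.
have V2P y : V2 (idx y, idx (h y)) y by split; exact: V_idx.
have [K [K0 KP]] : exists K, 0 < K /\ forall y (v : 'rV[R]_n), `|v *m A y| <= K * `|v|.
  have := @near_uniform R M _ V2 setT (fun ij r y => forall v : 'rV[R]_n,
    r * `|v *m chart_diff h (S (q ij.1)) (S (q ij.2)) y| <= `|v|) M_compact V2_closed.
  case=> [[i j] x _ [/= Vx Vhx]|e e0 eP].
    have := chart_diff_bound hsm (VS _ _ Vx) (VS _ _ Vhx).
    by apply: filterS => -[y r] /= hh _ _.
  exists (e / 2)^-1; split=> [|y v]; first by rewrite invr_gt0 divr_gt0.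
  rewrite AdE mulrC ler_pdivlMr ?divr_gt0 // mulrC.
  apply: (eP (e / 2) _ _ (idx y, idx (h y))) => //; last by rewrite divr_gt0.
  by rewrite /= sub0r normrN gtr0_norm ?divr_gt0 // ltr_pdivrMr // ltr_pMr // ltr1n.
(* The angle between E^u and E^s is bounded below because h expands the
   former and contracts the latter, with a bounded differential. *)
have P_bound y (v : 'rV[R]_n) : B y ->
    `|v *m P y| <= (K + 2) * `|v| /\ `|v *m (1%:M - P y)| <= (K + 2) * `|v|.
  move=> By.
  have e1 := expand_range (PP _ By) (PA _ By) (AAi y) (AiA y)
    (fun w => Ai_contr y w By) v.
  have vQP : v *m (1%:M - P y) *m P y = 0.
    by rewrite -mulmxA [(_ - _) *m P y]mulmxBl mul1mx PP // subrr mulmx0.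
  have e2 := A_contr _ _ By vQP.
  have e3 := KP y v.
  have vE : v *m (1%:M - P y) = v - v *m P y by rewrite mulmxBr mulmx1.
  have e4 : `|v *m P y *m A y| <= `|v *m A y| + `|v *m (1%:M - P y) *m A y|.
    have -> : v *m P y *m A y = v *m A y - v *m (1%:M - P y) *m A y.
      by rewrite vE -mulmxBl subKr.
    exact: ler_normB.
  have e5 : `|v *m (1%:M - P y)| <= `|v| + `|v *m P y| by rewrite vE ler_normB.
  have := normr_ge0 v; have := normr_ge0 (v *m P y).
  move: e1 e2 e3 e4 e5 => e1 e2 e3 e4 e5 n1 n2; split; lra.
(* Any [x] differs from [a] or from [b], and the small chart balls centred near [x] miss that
   point. *)
have hsep : forall a b, a <> b -> \forall r \near 0^'+, forall y u v, B y ->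
    `|u| <= r -> `|v| <= r -> chart_point c y u = a -> chart_point c y v = b -> False.
  move=> a b ab.
  have := @near_uniform R M I V B (fun i r y => forall u v : 'rV[R]_n,
    `|u| <= r -> `|v| <= r -> chart_inv (S (q i)) (S (q i) y + u) = a ->
    chart_inv (S (q i)) (S (q i) y + v) = b -> False) B_compact V_closed.
  case=> [i x Bx Vx|e e0 eP]; last first.
    by exists e => // r re r_gt0 y u v By; apply: (eP r re r_gt0 (idx y)).
  have nbhs_neq z : x <> z -> nbhs x (~` [set z]).
    move=> xz; apply: open_nbhs_nbhs; split; last by move=> /= xz'; exact: xz.
    by apply: closed_openC; apply: compact_closed => //; exact: compact_set1.
  have [xa|xa] := pselect (x = a).
    have xb : x <> b by rewrite xa.
    apply: filterS (chart_control (VS _ _ Vx) (nbhs_neq _ xb)) => -[y r] /= ctl _ _ u v _ vr _.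
    exact: (ctl _ vr).2.
  apply: filterS (chart_control (VS _ _ Vx) (nbhs_neq _ xa)) => -[y r] /= ctl _ _ u v ur _ ua _.
  exact: (ctl _ ur).2.
(* The graph transform tolerates exactly this error, [K + 2] being the bound on both projections. *)
pose eta := (2 * (K + 2))^-1.
have eta0 : 0 < eta by rewrite invr_gt0 mulr_gt0 // addr_gt0.
have near_approx := @near_uniform R M _ V2 B (fun ij r y => forall v w : 'rV[R]_n,
  `|v| <= r -> `|w| <= r ->
  `|S (q ij.2) (h (chart_inv (S (q ij.1)) (S (q ij.1) y + v)))
    - S (q ij.2) (h (chart_inv (S (q ij.1)) (S (q ij.1) y + w)))
    - (v - w) *m chart_diff h (S (q ij.1)) (S (q ij.2)) y| <= eta * `|v - w|)
  B_compact V2_closed.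
have near_control := @near_uniform R M _ V2 B (fun ij r y => forall v : 'rV[R]_n,
  `|v| <= r -> (S (q ij.1) @` chart_dom (S (q ij.1))) (S (q ij.1) y + v) /\
  (U `&` h @^-1` chart_dom (S (q ij.2))) (chart_inv (S (q ij.1)) (S (q ij.1) y + v)))
  B_compact V2_closed.
have [r [[r_gt0 approx] ctl]] : exists r : R, (0 < r /\ (forall y v w, B y ->
      `|v| <= r -> `|w| <= r ->
      `|S (c (h y)) (h (chart_point c y v)) - S (c (h y)) (h (chart_point c y w))
        - (v - w) *m A y| <= eta * `|v - w|)) /\
    forall y v, B y -> `|v| <= r -> (S (c y) @` chart_dom (S (c y))) (S (c y) y + v) /\
      (U `&` h @^-1` chart_dom (S (c (h y)))) (chart_point c y v).
  case: near_approx => [[i j] x _ [/= Vx Vhx]|e1 e10 ap].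
    have := chart_diff_approx eta0 hsm (VS _ _ Vx) (VS _ _ Vhx).
    by apply: filterS => -[y r] /= hh _ _.
  case: near_control => [[i j] x Bx [/= Vx Vhx]|e2 e20 ct].
    have Ox : nbhs x (U `&` h @^-1` chart_dom (S (q j))).
      apply: filterI; first by apply: open_nbhs_nbhs; split=> //; exact: BU.
      by apply: hsm.1; apply: chart_dom_nbhs; exact: VS.
    by apply: filterS (chart_control (VS _ _ Vx) Ox) => -[y r] /= hh _ _.
  have m0 : 0 < Num.min e1 e2 by rewrite lt_min; apply/andP.
  (* Halved because the estimates hold at radii strictly below [e1] and [e2]. *)
  pose r := Num.min e1 e2 / 2.
  have r_gt0 : 0 < r by rewrite divr_gt0.
  have : r < Num.min e1 e2 by rewrite ltr_pdivrMr // ltr_pMr // ltr1n.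
  rewrite lt_min => /andP[re1 re2].
  have {}ap := ap r _ r_gt0; have {}ct := ct r _ r_gt0.
  exists r; split; first split=> // y v w By vr wr.
    rewrite AdE; apply: (ap _ (idx y, idx (h y)) y) => //.
    by rewrite /= sub0r normrN gtr0_norm.
  move=> y v By vr; apply: (ct _ (idx y, idx (h y)) y By (V2P y) v vr).
  by rewrite /= sub0r normrN gtr0_norm.
(* Vectors of a graph over the ball of radius [d] have norm up to [2 * d], so [d = r / 2]. *)
exists N, c, P, (r / 2); rewrite /= -/h.
have r2 : 2 * (r / 2) = r by rewrite mulrC divfK.
have chart_point0 y : chart_point c y 0 = y by rewrite /chart_point addr0 chartK_in.
split=> //.
- by split=> //; rewrite divr_gt0.
- move=> y By; split; [exact: PP|exact: P_rank|move=> v; rewrite r2 => vr].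
  by have [? []] := ctl y v By vr.
move=> y G By GP; have Bhy := hB _ By.
have P'1 v := (P_bound _ v Bhy).1; have P'2 v := (P_bound _ v Bhy).2.
have etaK : 2 * eta * (K + 2) <= 1.
  have K2 : K + 2 != 0 by rewrite gt_eqF // addr_gt0.
  by rewrite /eta (_ : _ * _ * _ = 1) //; field.
have F0 : chart_map c h y 0 = 0 by rewrite /chart_map chart_point0 subrr.
have F_approx v w : `|v| <= 2 * (r / 2) -> `|w| <= 2 * (r / 2) ->
    `|chart_map c h y v - chart_map c h y w - (v - w) *m A y| <= eta * `|v - w|.
  rewrite r2 => vr wr; rewrite /chart_map opprB addrA subrK; exact: approx.
have r20 : 0 <= r / 2 by rewrite divr_ge0 // ltW.
split.
  exact: (graph_over_image (PP _ By) (PP _ Bhy) (PA _ By) (AAi y) (AiA y)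
    (fun w => Ai_contr y w By) (fun w => A_contr y w By) P'1 P'2 r20 (ltW eta0)
    etaK F0 F_approx GP).
move=> v Gv; have [G0 _ _ _] := GP.
have := graph_expand (PP _ By) (PA _ By) (AAi y) (AiA y)
    (fun w => Ai_contr y w By) P'1 P'2 (ltW eta0) etaK F_approx GP Gv G0.
by rewrite F0 !subr0.
Qed.

End HyperbolicCharts.

Lemma compact_ultra_limit (T : Type) (V : topologicalType) (K : set V)
    (F : set_system T) (u : T -> V) :
  UltraFilter F -> compact K -> (forall t, K (u t)) ->
  exists2 l, K l & u @ F --> l.
Proof.
move=> UF cK Ku.
have PF : ProperFilter F by exact: ultra_proper.
have KF : (u @ F) K by apply: (@filterS _ F _ setT) => [t _|]; [exact: Ku|exact: filterT].
have [l [Kl lc]] := cK _ (fmap_proper_filter u PF) KF.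
exists l => // W Wl.
have [//|nW] := in_ultra_setVsetC (u @^-1` W) UF.
by have [y [nWy Wy]] := lc (~` W) W nW Wl.
Qed.

(** * Unstable disks *)

Lemma projection_range_basis (F : fieldType) n (Q : 'M[F]_n) r :
  Q *m Q = Q -> \rank Q = r -> exists2 E : 'M[F]_(r, n), row_free E & E *m Q = E.
Proof.
move=> QQ <-; exists (row_base Q); first exact: row_base_free.
have /submxP[X ->] : (row_base Q <= Q)%MS by rewrite eq_row_base.
by rewrite -mulmxA QQ.
Qed.

Lemma projection_full_rank (F : fieldType) n (Q : 'M[F]_n) :
  Q *m Q = Q -> \rank Q = n -> Q = 1%:M.
Proof.
move=> QQ rQ; have Qu : Q \in unitmx by rewrite -row_free_unit /row_free rQ.
by rewrite -[LHS](mulKmx Qu) QQ mulVmx.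
Qed.

(** Radial retraction to the unit ball. It extends maps given on a disk to the whole plane, where
    invariance of domain asks for continuity. *)
Definition unit_clamp (R : realType) n (t : 'rV[R]_n) := (Num.max 1 `|t|)^-1 *: t.

Lemma unit_clamp_le (R : realType) n (t : 'rV[R]_n) : `|unit_clamp t| <= 1.
Proof.
have m0 : 0 < Num.max 1 `|t| by rewrite lt_max ltr01.
rewrite normrZ gtr0_norm ?invr_gt0 // mulrC ler_pdivrMr // mul1r.
by rewrite le_max lexx orbT.
Qed.

Lemma unit_clamp_id (R : realType) n (t : 'rV[R]_n) : `|t| <= 1 -> unit_clamp t = t.
Proof. by move=> t1; rewrite /unit_clamp max_l // invr1 scale1r. Qed.

Lemma unit_clamp_continuous (R : realType) n : continuous (@unit_clamp R n).
Proof.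
move=> t; have m0 : Num.max 1 `|t| != 0 by rewrite gt_eqF // lt_max ltr01.
have cm : {for t, continuous (fun t : 'rV[R]_n => Num.max 1 `|t|)}.
  apply: (@continuous_comp _ _ _ (fun t : 'rV[R]_n => `|t|) (fun r : R => Num.max 1 r)).
    exact: norm_continuous.
  by apply: continuous_max; [exact: cst_continuous|exact: cvg_id].
have cV : {for t, continuous (fun t : 'rV[R]_n => (Num.max 1 `|t|)^-1)}.
  by apply: continuousV; [exact: m0|exact: cm].
exact: (@cvgZ R _ _ (nbhs t) (nbhs_filter t) _ _ _ _ cV cvg_id).
Qed.

Lemma scaled_clamp_continuous (R : realType) n (k : R) :
  continuous (fun t : 'rV[R]_n => k *: unit_clamp t).
Proof.
move=> t; have ck : k @[_ --> t] --> k by exact: (@cst_continuous _ _ k t).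
exact: (@cvgZ R _ _ (nbhs t) (nbhs_filter t) _ _ _ _ ck (@unit_clamp_continuous R n t)).
Qed.

Section UnstableDisks.
Variables (R : realType) (n : nat) (M : topologicalType).
Variables (S : smooth_structure R n M) (B U : set M) (h hi : M -> M).
Hypothesis M_hausdorff : hausdorff_space M.
Hypotheses (hK : cancel h hi) (hiK : cancel hi h) (hi_cont : continuous hi).
Hypotheses (B_compact : compact B) (hB : forall y, B y -> B (h y)).
Hypothesis hiB : forall y, B y -> B (hi y).
Variables (c : M -> M) (P : M -> 'M[R]_n) (d : R).
Local Notation pt := (chart_point S c).
Local Notation F := (chart_map S c h).
Hypothesis d_gt0 : 0 < d.
Hypothesis c_dom : forall y, chart_dom (S (c y)) y.
Hypothesis PP : forall y, B y -> P y *m P y = P y.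
Hypothesis ctl : forall y, B y -> forall v, `|v| <= 2 * d ->
  [/\ (S (c y) @` chart_dom (S (c y))) (S (c y) y + v), U (pt y v) &
      chart_dom (S (c (h y))) (h (pt y v))].
Hypothesis step : forall y G, B y -> graph_over (P y) d G ->
  graph_over (P (h y)) d (graph_image (P (h y)) (F y) d G) /\
  forall v, G v -> 3 * `|v *m P y| <= `|F y v *m P (h y)|.

(** The flat unstable disk at [iter k hi y], pushed forward [k] times. Its points therefore come
    with controlled preimages for [k] steps back. *)
Fixpoint unstable_graph k y : set 'rV[R]_n :=
  match k with
  | 0 => [set v | v *m P y = v /\ `|v| <= d]
  | k'.+1 => graph_image (P y) (F (hi y)) d (unstable_graph k' (hi y))
  end.

Lemma unstable_graphP k y : B y -> graph_over (P y) d (unstable_graph k y).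
Proof.
elim: k y => [|k IH] y By /=; last first.
  by have [+ _] := step (hiB By) (IH _ (hiB By)); rewrite hiK.
split.
- by split; rewrite ?mul0mx // normr0 ltW.
- by move=> v [-> ].
- move=> v w [vP _] [wP _]; have -> : (v - w) *m (1%:M - P y) = 0.
    by rewrite mulmxBr mulmx1 mulmxBl vP wP subrr.
  by rewrite normr0.
- by move=> w wP wd; exists w.
Qed.

Lemma unstable_graph_small k y v : B y -> unstable_graph k y v -> `|v| <= 2 * `|v *m P y|.
Proof.
move=> By kv; have G := unstable_graphP k By; have [G0 _ _ _] := G.
by have := graph_over_norm G kv G0; rewrite !subr0.
Qed.

Lemma unstable_graph_le k y v : B y -> unstable_graph k y v -> `|v| <= 2 * d.
Proof.
move=> By kv; apply: le_trans (unstable_graph_small By kv) _.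
by have [_ Gd _ _] := unstable_graphP k By; rewrite ler_wpM2l // Gd.
Qed.

Lemma iter_hiB j y : B y -> B (iter j hi y).
Proof. by move=> By; elim: j => //= j; exact: hiB. Qed.

Lemma unstable_graph_back j k y v : B y -> unstable_graph (j + k) y v ->
  exists u, [/\ unstable_graph k (iter j hi y) u,
    iter j hi (pt y v) = pt (iter j hi y) u &
    3 ^+ j * `|u *m P (iter j hi y)| <= `|v *m P y|].
Proof.
elim: j y v => [|j IH] y v By; first by exists v; split; rewrite // expr0 mul1r.
move=> [v1 kv1 [vE _]]; have Bhy := hiB By.
have [u [ku uE uP]] := IH _ _ Bhy kv1.
exists u; rewrite !iterSr; split=> //.
  suff -> : hi (pt y v) = pt (hi y) v1 by [].
  have [_ _ dom] := ctl Bhy (unstable_graph_le Bhy kv1).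
  rewrite hiK in dom; suff -> : pt y v = h (pt (hi y) v1) by rewrite hK.
  by rewrite vE /chart_map hiK [LHS]/chart_point [_ + (_ - _)]addrC subrK chartK_in.
rewrite exprS -mulrA; apply: (@le_trans _ _ (3 * `|v1 *m P (hi y)|)).
  by rewrite ler_wpM2l.
have [_ expand] := step Bhy (unstable_graphP (j + k) Bhy).
have := expand _ kv1.
by rewrite -vE hiK.
Qed.

(** Unstable components, at most [d] at the start, are divided by 3 at each step back, and a vector
    of a graph is at most twice its unstable component. *)
Definition in_backward_ball x y := forall j, exists2 u,
  `|u| <= 2 * d / 3 ^+ j & iter j hi y = pt (iter j hi x) u.

Lemma unstable_graph_backward k j x v : B x -> unstable_graph k x v -> (j <= k)%N ->
  U (iter j hi (pt x v)) /\
  exists2 u, `|u| <= 2 * d / 3 ^+ j & iter j hi (pt x v) = pt (iter j hi x) u.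
Proof.
move=> Bx kv jk; rewrite -(subnKC jk) in kv.
have [u [ku uE uP]] := unstable_graph_back Bx kv.
have Bj := iter_hiB j Bx.
split; first by rewrite uE; have [] := ctl Bj (unstable_graph_le Bj ku).
exists u => //; apply: le_trans (unstable_graph_small Bj ku) _.
rewrite -mulrA ler_wpM2l // ler_pdivlMr ?exprn_gt0 // mulrC (le_trans uP) //.
by have [_ Gd _ _] := unstable_graphP (j + (k - j)) Bx; exact: Gd.
Qed.

Lemma pow3_le j : 2 * d / 3 ^+ j <= 2 * d.
Proof.
have d2 : 0 <= 2 * d by rewrite mulr_ge0 // ltW.
by rewrite ler_pdivrMr ?exprn_gt0 // ler_peMr // exprn_ege1 // ler1n.
Qed.

Lemma pt_cont y v : B y -> `|v| <= 2 * d -> {for v, continuous (pt y)}.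
Proof.
move=> By vd; have [im _ _] := ctl By vd.
apply: (@continuous_comp _ _ _ (fun v => S (c y) y + v) (chart_inv (S (c y)))).
  by apply: continuousD; [exact: cst_continuous|exact: cvg_id].
exact: chart_inv_cont.
Qed.

Lemma ball_compact (r : R) : compact [set u : 'rV[R]_n | `|u| <= r].
Proof.
apply: bounded_closed_compact.
  by exists r; split=> [|m rm v vr]; [exact: num_real|exact: le_trans vr (ltW rm)].
apply: (@closed_comp _ _ (fun v : 'rV[R]_n => `|v|) [set x | x <= r]).
  by move=> v _; exact: norm_continuous.
exact: closed_le.
Qed.

Lemma pt_ball_closed y j : B y ->
  closed (pt y @` [set u | `|u| <= 2 * d / 3 ^+ j]).
Proof.
move=> By; apply: compact_closed => //; apply: continuous_compact; last exact: ball_compact.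
apply: continuous_in_subspaceT => v; rewrite inE => vj.
by apply: pt_cont => //; exact: le_trans vj (pow3_le j).
Qed.

Lemma iter_hi_cont j : continuous (iter j hi).
Proof.
elim: j => [|j IH] x; first exact: cvg_id.
by apply: (@continuous_comp _ _ _ (iter j hi) hi); [exact: IH|exact: hi_cont].
Qed.

(** The local unstable manifold. Each conclusion is a closed condition on one or two points of the
    approximating graphs, so it survives in the limit; this is why [U] gives way to its closure. *)
Lemma unstable_disk x : B x -> exists v : 'rV[R]_n -> 'rV[R]_n,
  forall w, w *m P x = w -> `|w| <= d ->
  [/\ v w *m P x = w, `|v w| <= 2 * `|w|,
      forall w', w' *m P x = w' -> `|w'| <= d -> `|v w - v w'| <= 2 * `|w - w'|,
      forall j, closure U (iter j hi (pt x (v w))) &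
      in_backward_ball x (pt x (v w))].
Proof.
move=> Bx.
have [g gP] : exists g : nat -> 'rV[R]_n -> 'rV[R]_n, forall k w,
    w *m P x = w -> `|w| <= d -> unstable_graph k x (g k w) /\ g k w *m P x = w.
  suff /choice[g gP] : forall kw : nat * 'rV[R]_n, exists v,
      kw.2 *m P x = kw.2 -> `|kw.2| <= d -> unstable_graph kw.1 x v /\ v *m P x = kw.2.
    by exists (fun k w => g (k, w)) => k w; exact: (gP (k, w)).
  move=> [k w] /=; have [_ _ _ onto] := unstable_graphP k Bx.
  have [wP|] := pselect (w *m P x = w); last by exists 0.
  have [wd|] := pselect (`|w| <= d); last by exists 0.
  by have [v] := onto w wP wd; exists v.
(* The same ultrafilter serves all [w], so Lipschitz bounds between two values of the limit make
   sense. *)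
have [F0 [UF F0oo]] := @ultraFilterLemma nat \oo _.
have [v vP] : {v : 'rV[R]_n -> 'rV[R]_n & forall w, w *m P x = w -> `|w| <= d ->
    `|v w| <= 2 * d /\ g^~ w @ F0 --> v w}.
  apply: (@choice _ _ (fun w l => w *m P x = w -> `|w| <= d ->
    `|l| <= 2 * d /\ g^~ w @ F0 --> l)) => w.
  have [wP|] := pselect (w *m P x = w); last by exists 0.
  have [wd|] := pselect (`|w| <= d); last by exists 0.
  have [l lK lc] := @compact_ultra_limit _ _ _ F0 (g^~ w) UF (@ball_compact (2 * d))
    (fun k => unstable_graph_le Bx (gP k w wP wd).1).
  by exists l.
exists v => w wP wd; have [vd vlim] := vP w wP wd.
have PF : ProperFilter F0 by exact: ultra_proper.
have zlim j : iter j hi (pt x (g k w)) @[k --> F0] --> iter j hi (pt x (v w)).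
  apply: (@cvg_comp _ _ _ (fun k => pt x (g k w)) (iter j hi) _ (nbhs (pt x (v w)))).
    by apply: (@cvg_comp _ _ _ (g^~ w) (pt x) _ (nbhs (v w))) => //; exact: pt_cont.
  exact: iter_hi_cont.
(* Stage [k] controls only the first [k] backward iterates; for fixed [j] this excludes finitely
   many stages. *)
have late j : \forall k \near F0, (j <= k)%N by apply: F0oo; exact: nbhs_infty_ge.
split=> //.
- have e := cvg_comp _ _ vlim (@mulmx_continuous _ _ _ (P x) (v w)).
  apply: (@closed_cvg _ _ _ PF (mulmxr (P x) \o g^~ w) [set w]) e.
    by apply: compact_closed; [exact: norm_hausdorff|exact: compact_set1].
  by apply: nearW => k /=; exact: (gP k w wP wd).2.
- have e : `|g k w| @[k --> F0] --> `|v w| by exact: cvg_norm.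
  apply: (@closed_cvg _ _ _ PF _ [set r | r <= 2 * `|w|]) e; first exact: closed_le.
  apply: nearW => k /=; have [k1 k2] := gP k w wP wd.
  by rewrite (le_trans (unstable_graph_small Bx k1)) // k2.
- move=> w' w'P w'd; have [_ v'lim] := vP w' w'P w'd.
  have e : `|g k w - g k w'| @[k --> F0] --> `|v w - v w'|.
    by apply: cvg_norm; exact: cvgB.
  apply: (@closed_cvg _ _ _ PF _ [set r | r <= 2 * `|w - w'|]) e; first exact: closed_le.
  apply: nearW => k /=; have [k1 k2] := gP k w wP wd; have [k1' k2'] := gP k w' w'P w'd.
  by rewrite (le_trans (graph_over_norm (unstable_graphP k Bx) k1 k1')) // mulmxBl k2 k2'.
- move=> j; apply: (@closed_cvg _ _ _ PF _ (closure U)) (zlim j); first exact: closed_closure.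
  apply: filterS (late j) => k jk; apply: subset_closure.
  exact: (unstable_graph_backward Bx (gP k w wP wd).1 jk).1.
- move=> j.
  suff [u /= ud <-] : (pt (iter j hi x) @` [set u | `|u| <= 2 * d / 3 ^+ j])
      (iter j hi (pt x (v w))) by exists u.
  apply: (@closed_cvg _ _ _ PF _ _) (zlim j); first exact/pt_ball_closed/iter_hiB.
  apply: filterS (late j) => k jk.
  have [_ [u ud ->]] := unstable_graph_backward Bx (gP k w wP wd).1 jk.
  by exists u.
Qed.

Hypothesis sep : forall a b, a <> b -> \forall r \near (0 : R)^'+, forall y u v, B y ->
  `|u| <= r -> `|v| <= r -> pt y u = a -> pt y v = b -> False.

(* Each of the finitely many sets O_x shrinks to a point under backward
   iteration, so two of any size s + 1 points of B cannot stay apart. *)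
Lemma backward_contracting_finite :
  (forall x, B x -> exists2 O, nbhs x O & forall y, B y -> O y -> in_backward_ball x y) ->
  finite_set B.
Proof.
move=> loc; apply: contrapT => inf.
have [W WP] : {W : M -> set M & forall x, B x ->
    nbhs x (W x) /\ forall y, B y -> W x y -> in_backward_ball x y}.
  apply: (@choice _ _ (fun x O => B x -> nbhs x O /\
    forall y, B y -> O y -> in_backward_ball x y)) => x.
  by have [/loc [W]|] := pselect (B x); [exists W|exists setT].
have [s sP] := compact_finite_subcover B_compact (fun x Bx => (WP x Bx).1).
have [A AB sA] := infinite_set_fset (size s).+1 inf.
pose a := finmap.enum_fset A.
have aB i : B (tnth (in_tuple a) i) by apply: AB => /=; exact: mem_tnth.
pose apart (ij : 'I_(size a) * 'I_(size a)) (r : R) :=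
  tnth (in_tuple a) ij.1 <> tnth (in_tuple a) ij.2 ->
  forall y u v, B y -> `|u| <= r -> `|v| <= r ->
    pt y u = tnth (in_tuple a) ij.1 -> pt y v = tnth (in_tuple a) ij.2 -> False.
have apart_near ij : \forall r \near (0 : R)^'+, apart ij r.
  have [eq|neq] := pselect (tnth (in_tuple a) ij.1 = tnth (in_tuple a) ij.2).
    by apply: filterS filterT => r _ /(_ eq).
  by apply: filterS (sep neq) => r rP _.
have [e /= e0 eP] := filter_forall _ apart_near.
pose r := e / 2.
have r_gt0 : 0 < r by rewrite divr_gt0.
have rP : forall ij, apart ij r.
  by apply: eP => //=; rewrite sub0r normrN gtr0_norm // ltr_pdivrMr // ltr_pMr // ltr1n.
(* At this time the backward image of the part of [B] in a single [W x] fits in a chart ball of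
   radius [r], and by the choice of [r] such a ball cannot hold two distinct points of [a]. *)
have [k kr] : exists k, 2 * d / 3 ^+ k <= r.
  have l1 : `|3^-1 : R| < 1 by rewrite ger0_norm // invf_lt1 // ltr1n.
  have d2 : 0 < 2 * d by rewrite mulr_gt0.
  have /cvgrPdist_lt /(_ (r / (2 * d))) := cvg_expr l1.
  rewrite divr_gt0 // => /(_ isT) [k _ /(_ k (leqnn k))] /=.
  rewrite sub0r normrN ger0_norm ?exprn_ge0 ?invr_ge0 // exprVn => h3.
  by exists k; rewrite mulrC -ler_pdivlMr // ltW.
have [phi phiP] : {phi : M -> M & forall y, B y ->
    phi y \in s /\ B (phi y) /\ W (phi y) (iter k h y)}.
  apply: (@choice _ _ (fun y x => B y -> x \in s /\ B x /\ W x (iter k h y))) => y.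
  have [By|] := pselect (B y); last by exists y.
  have Bk : B (iter k h y) by elim: (k) => //= m; exact: hB.
  by have [x xs ?] := sP _ Bk; exists x.
have iterK y : iter k hi (iter k h y) = y.
  by elim: (k) y => // m IH y; rewrite iterSr [iter m.+1 h y]iterS hK IH.
suff /uniq_leq_size /(_ _) le : uniq (map phi a).
  have /le : {subset map phi a <= s}.
    by move=> _ /mapP[y ya ->]; apply: (phiP y _).1; exact: AB.
  by rewrite size_map leqNgt sA.
rewrite map_inj_in_uniq ?finmap.fset_uniq // => y y' /(tnthP (in_tuple a))[i ->].
move=> /(tnthP (in_tuple a))[j ->] pij; apply: contrapT => neq.
have [_ [Bi Oi]] := phiP _ (aB i); have [_ [_ Oj]] := phiP _ (aB j).
have hk y0 : B y0 -> B (iter k h y0) by move=> ?; elim: (k) => //= m; exact: hB.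
have [u ur uE] := (WP _ Bi).2 _ (hk _ (aB i)) Oi k.
rewrite -pij in Oj; have [v vr vE] := (WP _ Bi).2 _ (hk _ (aB j)) Oj k.
rewrite !iterK in uE vE.
exact: (rP (i, j) neq _ u v (iter_hiB k Bi) (le_trans ur kr) (le_trans vr kr)).
Qed.

(** Once [P x] is the identity, every stage is the full ball of radius [d]. The coordinates of a
    nearby [y] thus belong to stage [j] for each [j], and stage [j] controls the [j]-th backward
    iterate. *)
Lemma full_rank_backward_nbhs x : B x -> \rank (P x) = n ->
  exists2 O, nbhs x O & forall y, B y -> O y -> in_backward_ball x y.
Proof.
move=> Bx rP; have P1 := projection_full_rank (PP Bx) rP.
exists (chart_dom (S (c x)) `&` [set y | `|S (c x) y - S (c x) x| < d]).
  apply: filterI; first exact: chart_dom_nbhs.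
  exact: ((@cvgrPdistC_lt _ _ _ _ (nbhs_filter x) _ _).1 (chart_cont (c_dom x)) d d_gt0).
move=> y By [/= ydom yd] j.
have [_ _ _ onto] := unstable_graphP j Bx.
have [|u ju] := onto (S (c x) y - S (c x) x) _ (ltW yd); first by rewrite P1 mulmx1.
rewrite P1 mulmx1 => uE.
have [_] := unstable_graph_backward Bx ju (leqnn j).
have -> : pt x u = y by rewrite /chart_point uE addrC subrK chartK_in.
by [].
Qed.

Hypothesis B_trap : forall z, (forall j, closure U (iter j hi z)) -> B z.
Variables (N : topologicalType) (e : N -> M).
Hypothesis N_surface : closed_topological_manifold R 2 N.
Hypothesis e_emb : topological_embedding e.
Hypothesis Be : B `<=` range e.

(* The unstable disk through x, read in a chart of the surface, is an injective
   image of a planar disk, hence open: it contains all points of B near x. *)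
Lemma surface_backward_nbhs x : B x -> \rank (P x) = 2 ->
  exists2 O, nbhs x O & forall y, B y -> O y -> in_backward_ball x y.
Proof.
move=> Bx rP.
have [e_inj e_cont e_open] := e_emb.
have [_ _ N_chart] := N_surface.
have [v vP] := unstable_disk Bx.
have [E E_free EP] := projection_range_basis (PP Bx) rP.
have [n0 en0] : exists n0, e n0 = x by have [n0 _ ?] := Be Bx; exists n0.
have [einv einvP] : {einv : M -> N & forall y, B y -> e (einv y) = y}.
  apply: (@choice _ _ (fun y m => B y -> e m = y)) => y.
  by have [/Be[m _ ?]|] := pselect (B y); [exists m|exists n0].
(* In [norm_mulmx] the factor is the number of rows of [E], here 2; adding 1 keeps the denominator
   positive. *)
pose eps := d / (2 * `|E| + 1).
have E1 : 0 < 2 * `|E| + 1 by rewrite ltr_wpDl // mulr_ge0.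
have eps0 : 0 < eps by rewrite divr_gt0.
pose w (t : 'rV[R]_2) := (eps *: unit_clamp t) *m E.
have wE t : w t *m P x = w t by rewrite -mulmxA EP.
have wd t : `|w t| <= d.
  apply: le_trans (norm_mulmx _ _) _; rewrite normrZ (gtr0_norm eps0).
  apply: (@le_trans _ _ (2 * `|E| * eps)).
    rewrite ler_wpM2l ?mulr_ge0 // ler_piMr ?unit_clamp_le //; exact: ltW.
  by rewrite /eps mulrA ler_pdivrMr // mulrC ler_wpM2l ?lerDl // ltW.
have w0 : w 0 = 0 by rewrite /w unit_clamp_id ?normr0 // scaler0 mul0mx.
have w_cont : continuous w.
  move=> t; apply: (@continuous_comp _ _ _ (fun t => eps *: unit_clamp t) (mulmxr E)).
    exact: scaled_clamp_continuous.
  exact: mulmx_continuous.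
pose Z t := pt x (v (w t)).
have vw t := vP _ (wE t) (wd t).
have vd t : `|v (w t)| <= 2 * d.
  by have [_ vt _ _ _] := vw t; rewrite (le_trans vt) // ler_wpM2l.
have v_cont : continuous (v \o w).
  move=> t; apply/(@cvgrPdist_lt _ _ _ _ (nbhs_filter t)) => r r0.
  have r20 : 0 < r / 2 by rewrite divr_gt0.
  have := (@cvgrPdist_lt _ _ _ _ (nbhs_filter t) _ _).1 (w_cont t) _ r20.
  apply: filterS => t' /= wt'.
  have [_ _ lip _ _] := vw t; apply: le_lt_trans (lip _ (wE t') (wd t')) _.
  by rewrite mulrC -ltr_pdivlMr.
have Z_cont : continuous Z.
  move=> t; apply: (@continuous_comp _ _ _ (v \o w) (pt x)); first exact: v_cont.
  exact: (pt_cont Bx (vd t)).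
have ZB t : B (Z t) by apply: B_trap; have [] := vw t.
have Z0 : Z 0 = x.
  have [_ v0 _ _ _] := vw 0; rewrite w0 normr0 mulr0 normr_le0 in v0.
  by rewrite /Z w0 (eqP v0) /chart_point addr0 chartK_in.
(* Applying [P x] to the chart coordinates recovers [w t], and the rows of [E] are independent. *)
have Z_inj t t' : `|t| <= 1 -> `|t'| <= 1 -> Z t = Z t' -> t = t'.
  move=> t1 t'1 /(congr1 (S (c x))).
  have [im _ _] := ctl Bx (vd t); have [im' _ _] := ctl Bx (vd t').
  rewrite /Z /chart_point (chart_invK im).2 (chart_invK im').2 => /addrI vv.
  have [e1 _ _ _ _] := vw t; have [e2 _ _ _ _] := vw t'.
  move: e1; rewrite vv e2 /w => /(row_free_inj E_free) /(scalerI _).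
  by rewrite !unit_clamp_id // => ->//; rewrite gt_eqF.
(* The disk lifted to the abstract surface; the lift is continuous because open sets of [N] are
   traces of open sets of [M]. *)
pose p t := einv (Z t).
have ep t : e (p t) = Z t by exact: einvP.
have p0 : p 0 = n0 by apply: e_inj; rewrite ep Z0.
have p_cont : continuous p.
  move=> t W; rewrite nbhsE => -[W' [oW' W't] W'W].
  have [V oV VW'] := e_open _ oW'.
  have Vt : nbhs (Z t) V.
    by apply: open_nbhs_nbhs; split=> //; rewrite -ep; move: W't; rewrite -VW'.
  apply: (@filterS _ _ (nbhs_filter t) _ _ _ (Z_cont t _ Vt)) => t' Vt'; apply: W'W.
  by rewrite -VW' /= ep.
have [k kn0] := N_chart n0.
have /nbhs_ballP[rho /= rho0 rhoP] : nbhs (0 : 'rV[R]_2) (p @^-1` chart_dom k).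
  by apply: p_cont; rewrite p0; exact: chart_dom_nbhs.
(* Shrinks the disk until its lift lies in the domain of the surface chart [k]. *)
pose s := Num.min 1 (rho / 2).
have s0 : 0 < s by rewrite lt_min ltr01 divr_gt0.
have s_le1 (t : 'rV[R]_2) : `|s *: unit_clamp t| <= 1.
  rewrite normrZ gtr0_norm //; apply: mulr_ile1; rewrite ?unit_clamp_le ?normr_ge0 //.
    exact: ltW.
  by rewrite /s ge_min lexx.
have pk t : chart_dom k (p (s *: unit_clamp t)).
  apply: rhoP; rewrite -ball_normE /= sub0r normrN normrZ gtr0_norm //.
  apply: (@le_lt_trans _ _ s); first exact/ler_piMr/unit_clamp_le/ltW.
  by rewrite /s gt_min ltr_pdivrMr // ltr_pMr // ltr1n orbT.
pose phi t := k (p (s *: unit_clamp t)).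
have phi_cont : continuous phi.
  move=> t; apply: (@continuous_comp _ _ _ (fun t => p (s *: unit_clamp t)) k).
    apply: (@continuous_comp _ _ _ (fun t => s *: unit_clamp t) p); last exact: p_cont.
    exact: scaled_clamp_continuous.
  exact/chart_cont/pk.
have phi_inj : {in [set t | `|t| <= 1] &, injective phi}.
  move=> t t'; rewrite !inE => t1 t'1 /(congr1 (chart_inv k)).
  rewrite /phi !chartK_in // => /(congr1 e); rewrite !ep.
  move=> /(Z_inj _ _ (s_le1 t) (s_le1 t')) /(scalerI _).
  by rewrite !unit_clamp_id // => ->//; rewrite gt_eqF.
have phi0 : phi 0 = k n0.
  by rewrite /phi unit_clamp_id ?normr0 // scaler0 p0.
have := planar_invariance_of_domain phi_cont phi_inj; rewrite phi0 => im.
have : nbhs n0 (chart_dom k `&` k @^-1` (phi @` [set t | `|t| <= 1])).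
  by apply: filterI; [exact: chart_dom_nbhs|exact: (chart_cont kn0)].
rewrite nbhsE => -[W [oW Wn0] WP].
have [V oV VW] := e_open _ oW.
exists V.
  by apply: open_nbhs_nbhs; split=> //; rewrite -en0; move: Wn0; rewrite -VW.
move=> y By Vy.
have /WP[/= ydom [t _ tE]] : W (einv y) by rewrite -VW /= einvP.
have -> : y = Z (s *: unit_clamp t).
  rewrite -(einvP y By) -ep; congr (e _).
  by rewrite -(chartK_in ydom) -tE /phi chartK_in.
by have [] := vw (s *: unit_clamp t).
Qed.

End UnstableDisks.

(** * Basic sets *)

(** In a Hausdorff space the complement of the other points is an open set that meets a finite set
    in one point alone, so these complements refine any cover and have disjoint traces. *)
Lemma finite_covering_dim0 (T : topologicalType) (B : set T) :
  hausdorff_space T -> finite_set B -> covering_dim_le B 0.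
Proof.
move=> hT finB m U U_open BU.
have [s Bs] := (finite_seqP B).1 finB.
(* Without repetitions, distinct indices name distinct points, as disjointness of the traces
   requires. *)
pose a (j : 'I_(size (undup s))) := tnth (in_tuple (undup s)) j.
have aB j : B (a j) by rewrite Bs /= -mem_undup mem_tnth.
have Ba y : B y -> exists j, y = a j.
  rewrite Bs /= -mem_undup => /(tnthP (in_tuple (undup s)))[j ->]; by exists j.
have a_inj i j : a i = a j -> i = j.
  rewrite /a !(tnth_nth (a i)) /= => /eqP.
  by rewrite nth_uniq ?undup_uniq // => /eqP /val_inj.
exists (size (undup s)), (fun j => ~` (B `\ a j)).
have VB j y : B y -> (~` (B `\ a j)) y -> y = a j.
  by move=> By nV; apply: contrapT => ya; apply: nV.
split=> [j|y By|j|J J1].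
- apply: closed_openC; apply: compact_closed => //; apply: finite_compact.
  exact: finite_setD.
- by have [j ->] := Ba y By; exists j => // -[_]; apply.
- have [i _ Ui] := BU _ (aB j); exists i => y [Vy By].
  by rewrite (VB j y By Vy).
- rewrite -subset0 => y [By Vy].
  have [i iJ [j jJ /eqP]] : exists2 i, i \in J & exists2 j, j \in J & i != j.
    by move: J1 => /card_gt1P[i [j [iJ jJ ij]]]; exists i => //; exists j.
  apply; apply: a_inj.
  by rewrite -(VB i y By (Vy i iJ)) -(VB j y By (Vy j jJ)).
Qed.

(** * Exchange of the bundles under inversion, and constancy of their ranks *)

Section InverseSplitting.
Variables (R : realType) (n : nat) (M : topologicalType).
Variables (S : smooth_structure R n M).
Implicit Types (f : diffeomorphism S) (L : set M) (Es Eu : M -> 'M[R]_n).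

Lemma invariant_set_inverse f L :
  invariant_set f L -> invariant_set (inverse_diffeo f) L.
Proof.
move=> Lf; apply/seteqP; split=> [_ [x Lx <-]|x Lx] /=; first exact: invariant_inv.
by exists (f x); [rewrite -Lf; exists x|rewrite diffeoK].
Qed.

Lemma tangent_map_invK f x :
  tangent_map S f (diffeo_inv f x) *m tangent_map S (diffeo_inv f) x = 1%:M.
Proof.
have := @tangent_map_comp _ _ _ S f (diffeo_inv f) (diffeo_inv f x)
  (diffeo_smooth f) (diffeo_inv_smooth f).
rewrite diffeoVK => <-.
have -> : diffeo_inv f \o f = id by apply/funext => y; exact: diffeoK.
exact: tangent_map_id.
Qed.

Lemma hyperbolic_splitting_inverse f L Es Eu : invariant_set f L ->
  hyperbolic_splitting f L Es Eu -> hyperbolic_splitting (inverse_diffeo f) L Eu Es.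
Proof.
move=> Lf [[cs cu] full inv [g [gR [C [lam [C0 lam1 hs hu]]]]]].
have back (E : M -> 'M[R]_n) x : (E (diffeo_inv f x) *m tangent_map S f (diffeo_inv f x) ==
    E (f (diffeo_inv f x)))%MS ->
    (E x *m tangent_map S (diffeo_inv f) x == E (diffeo_inv f x))%MS.
  rewrite diffeoVK => /eqmxP eqE; apply/eqmxP; apply: eqmx_sym.
  apply: eqmx_trans (eqmxMr (tangent_map S (diffeo_inv f) x) eqE).
  by rewrite -mulmxA tangent_map_invK mulmx1; exact: eqmx_refl.
split; first by split.
- by move=> x Lx; rewrite addsmxC capmxC; exact: full.
- move=> x Lx; have [i1 i2] := inv _ (invariant_inv Lf Lx).
  by split; exact: back.
- by exists g; split=> //; exists C, lam; split.
Qed.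

Lemma tangent_map_unit f x : tangent_map S f x \in unitmx.
Proof.
have := tangent_map_invK f (f x); rewrite diffeoK => h.
exact: (mulmx1_unit h).1.
Qed.

Lemma splitting_rank_sum f L Es Eu x : hyperbolic_splitting f L Es Eu -> L x ->
  (\rank (Es x) + \rank (Eu x) = n)%N.
Proof.
move=> [_ full _ _] /full[/eqmxP sum /eqmxP cap].
by rewrite -mxrank_sum_cap sum cap mxrank1 mxrank0 addn0.
Qed.

(** A local frame has a fixed number of independent rows, and changes of chart are invertible. *)
Lemma subbundle_rank_locally_constant L (E : M -> 'M[R]_n) x :
  continuous_subbundle S L E -> L x ->
  exists2 V, open V /\ V x & forall y, V y -> L y -> \rank (E y) = \rank (E x).
Proof.
move=> cE Lx; have [V [k [A [oV Vx VS _ VA]]]] := cE x Lx.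
exists V; first by split.
have rk y : V y -> L y -> \rank (E y) = k.
  move=> Vy Ly; have [A_free /eqmxP AE] := VA y (conj Vy Ly).
  move/eqP: A_free => <-; rewrite AE mxrankMfree //.
  have h := chart_jacK (chart_at_dom S y) (VS _ Vy).
  by rewrite row_free_unit (mulmx1_unit h).1.
by move=> y Vy Ly; rewrite !rk.
Qed.

(** Invertibility of the differential keeps the rank constant along the dense orbit, and that orbit
    visits the neighborhoods on which the rank is locally constant. *)
Lemma unstable_rank_constant f L B Es Eu : invariant_set f L -> invariant_set f B ->
  B `<=` L -> hyperbolic_splitting f L Es Eu -> has_dense_orbit f B ->
  exists r, forall x, B x -> \rank (Eu x) = r.
Proof.
move=> Lf Bf BL [[_ cu] _ inv _] [x Bx dense].
have rk_f y : L y -> \rank (Eu (f y)) = \rank (Eu y).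
  move=> Ly; have [_ /eqmxP h] := inv y Ly.
  by rewrite -h mxrankMfree // row_free_unit tangent_map_unit.
have rk k : L (iterz f k x) /\ \rank (Eu (iterz f k x)) = \rank (Eu x).
  have Lx := BL x Bx; case: k => k /=.
    by elim: k => //= k [Lk IH]; rewrite rk_f //; split=> //; rewrite -Lf; exists (iter k f x).
  have back y : L y -> L (diffeo_inv f y) /\ \rank (Eu (diffeo_inv f y)) = \rank (Eu y).
    move=> Ly; have Ly' := invariant_inv Lf Ly; split=> //.
    by rewrite -[in RHS](diffeoVK f y) rk_f.
  elim: k => [|k [Lk IH]] /=; first exact: back.
  by have [L' ->] := back _ Lk; split.
exists (\rank (Eu x)) => y By.
have [V [oV Vy] Vrk] := subbundle_rank_locally_constant cu (BL y By).
have [z [[k _ <-] Vz]] := dense y By V (open_nbhs_nbhs (conj oV Vy)).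
by rewrite -(Vrk _ Vz (rk k).1) (rk k).2.
Qed.

End InverseSplitting.

(** * Finiteness of basic sets with a large unstable bundle *)

Section ExpandingBasicSets.
Variables (R : realType) (n : nat) (M : topologicalType).
Variables (S : smooth_structure R n M) (f : diffeomorphism S).
Variables (L B : set M) (Es Eu : M -> 'M[R]_n).
Hypotheses (n_gt0 : (0 < n)%N) (M_hausdorff : hausdorff_space M).
Hypothesis M_compact : compact [set: M].
Hypotheses (L_inv : invariant_set f L) (hyp : hyperbolic_splitting f L Es Eu).
Hypotheses (B_closed : closed B) (B_inv : invariant_set f B) (BL : B `<=` L).

Let B_compact : compact B.
Proof. exact: subclosed_compact B_closed M_compact _. Qed.

Lemma iter_inv_invariant N y : B y -> B (iter N (diffeo_inv f) y).
Proof. by move=> By; elim: N => //= N; exact: invariant_inv. Qed.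

Lemma iter_inv_continuous N : continuous (iter N (diffeo_inv f)).
Proof. by have [] := iter_chart_smooth N (diffeo_inv_smooth f). Qed.

(** An unstable disk of full rank already contains every point near its centre, so the neighborhood
    [U] of [hyperbolic_charts] is all of [M] here. *)
Lemma full_unstable_finite : (forall y, B y -> \rank (Eu y) = n) -> finite_set B.
Proof.
move=> rk; have [[x0 Bx0]|B0] := pselect (B !=set0); last first.
  by rewrite (_ : B = set0) // -subset0 => y By; apply: B0; exists y.
have [N [c [P [d /= [[_ d0] c_dom ctl step sep]]]]] := hyperbolic_charts n_gt0
  M_hausdorff M_compact L_inv hyp B_closed B_inv BL (ex_intro _ x0 Bx0) openT (@subsetT _ B).
have hK := iter_diffeoK f N; have hiK := iter_diffeoVK f N.
have hB y : B y -> B (iter N f y) by exact: invariant_iter.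
have PP y : B y -> P y *m P y = P y by move=> /ctl[].
have ctl' y : B y -> forall v, `|v| <= 2 * d ->
    [/\ (S (c y) @` chart_dom (S (c y))) (S (c y) y + v), [set: M] (chart_point S c y v) &
      chart_dom (S (c (iter N f y))) (iter N f (chart_point S c y v))].
  by move=> /ctl[].
apply: (backward_contracting_finite hK B_compact hB
  (iter_inv_invariant N) d0 sep) => x Bx.
apply: (full_rank_backward_nbhs hK hiK (iter_inv_invariant N) d0 c_dom PP ctl' step Bx).
by have [_ -> _] := ctl x Bx; exact: rk.
Qed.

Variable T : set M.
Hypotheses (F_surface : embedded_closed_surface R T) (BF : B `<=` T).

Lemma surface_attractor_finite : attractor f B ->
  (forall y, B y -> \rank (Eu y) = 2) -> finite_set B.
Proof.
move=> [U [U_closed BU fU BE]] rk.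
have [[x0 Bx0]|B0] := pselect (B !=set0); last first.
  by rewrite (_ : B = set0) // -subset0 => y By; apply: B0; exists y.
have [N [c [P [d /= [[N0 d0] c_dom ctl step sep]]]]] := hyperbolic_charts n_gt0
  M_hausdorff M_compact L_inv hyp B_closed B_inv BL (ex_intro _ x0 Bx0)
  (@open_interior _ U) BU.
have hK := iter_diffeoK f N; have hiK := iter_diffeoVK f N.
have hB y : B y -> B (iter N f y) by exact: invariant_iter.
have PP y : B y -> P y *m P y = P y by move=> /ctl[].
have ctl' y : B y -> forall v, `|v| <= 2 * d ->
    [/\ (S (c y) @` chart_dom (S (c y))) (S (c y) y + v), U° (chart_point S c y v) &
      chart_dom (S (c (iter N f y))) (iter N f (chart_point S c y v))].
  by move=> /ctl[].
have iterU k y : U y -> U (iter k f y).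
  by move=> Uy; elim: k => //= k Uk; apply: interior_subset; apply: fU; exists (iter k f y).
(* Only backward times that are multiples of [N] are controlled. The iterate at time [- k] is
   reached from the one at time [- (k * N)] by going forward, which preserves [U]. *)
have trap z : (forall j, closure U° (iter j (iter N (diffeo_inv f)) z)) -> B z.
  move=> zU; rewrite -BE => k _.
  have Uk : U (iter (k * N) (diffeo_inv f) z).
    rewrite iterM ((closure_id U).1 U_closed).
    exact: (closureS (@interior_subset _ U) (zU k)).
  have kN : (k <= k * N)%N by rewrite leq_pmulr.
  exists (iter (k * N - k) f (iter (k * N) (diffeo_inv f) z)); first exact: iterU.
  by rewrite -iterD subnKC // iter_diffeoVK.
have [F [e [F_man e_emb eF]]] := F_surface.
have Be : B `<=` range e by rewrite eF.
apply: (backward_contracting_finite hK B_compact hB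
  (iter_inv_invariant N) d0 sep) => x Bx.
apply: (surface_backward_nbhs M_hausdorff hK hiK (@iter_inv_continuous N)
  (iter_inv_invariant N) d0 c_dom PP ctl' step trap F_man e_emb Be Bx).
by have [_ -> _] := ctl x Bx; exact: rk.
Qed.

End ExpandingBasicSets.

Theorem lemma1 (R : realType) (M : topologicalType)
    (S : smooth_structure R 3 M)
    (M_hausdorff : hausdorff_space M) (M_compact : compact [set: M]%classic)
    (M_orientable : orientable S)
    (f : diffeomorphism S) (f_A : A_diffeomorphism f)
    (B : set M) (B_surface : surface_basic_set f B)
    (B_dim2 : topological_dim B 2) :
  (attractor f B -> basic_set_type f B 2 1) /\
  (repeller f B -> basic_set_type f B 1 2).
Proof.
have [[_ L_inv [Es [Eu hyp]]] _] := f_A.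
have [B_basic [F [F_surface _ BF]]] := B_surface.
have [B_closed B_inv B_dense BL] : [/\ closed B, invariant_set f B,
    has_dense_orbit f B & B `<=` nonwandering f].
  have [m [Om [OmP _ OmNW [i OmB]]]] := B_basic.
  have [] := OmP i; rewrite OmB => ? ? ?; split=> //.
  by rewrite -OmNW -OmB => y; exists i.
have B_infinite : ~ finite_set B.
  by move=> /(finite_covering_dim0 M_hausdorff); exact: B_dim2.2.
have [r rkU] := unstable_rank_constant L_inv B_inv BL hyp B_dense.
have rkS y : B y -> (\rank (Es y) + r = 3)%N.
  by move=> By; rewrite -(rkU y By) (splitting_rank_sum hyp) //; exact: BL.
have hyp' := hyperbolic_splitting_inverse L_inv hyp.
have L_inv' := invariant_set_inverse L_inv.
have B_inv' := invariant_set_inverse B_inv.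
have r3 : r <> 3.
  move=> r3; apply: B_infinite.
  apply: (full_unstable_finite _ M_hausdorff M_compact L_inv hyp B_closed B_inv BL) => //.
  by move=> y By; rewrite rkU.
(* Rank 0 for E^u is rank 3 for E^s, the unstable bundle of the inverse. *)
have r0 : r <> 0.
  move=> r0; apply: B_infinite.
  apply: (full_unstable_finite _ M_hausdorff M_compact L_inv' hyp' B_closed B_inv' BL) => //.
  by move=> y By; have := rkS y By; rewrite r0 addn0.
have [x0 Bx0 _] := B_dense.
have r_le3 : (r <= 3)%N by rewrite -(rkS x0 Bx0) leq_addl.
split=> [att|rep].
  have r2 : r <> 2.
    move=> r2; apply: B_infinite.
    apply: (surface_attractor_finite _ M_hausdorff M_compact L_inv hyp B_closed B_inv BL
      F_surface BF att) => //.
    by move=> y By; rewrite rkU.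
  have r1 : r = 1%N by case: r r0 r2 r3 r_le3 {rkS rkU} => [|[|[|[|?]]]].
  exists Es, Eu; split=> // y By; split; last by rewrite rkU.
  by have := rkS y By; rewrite r1 addn1 => -[].
(* A repeller is an attractor of the inverse, whose unstable bundle [Es] would have rank 2. *)
have r1 : r <> 1%N.
  move=> r1; apply: B_infinite.
  apply: (surface_attractor_finite _ M_hausdorff M_compact L_inv' hyp' B_closed B_inv' BL
    F_surface BF rep) => //.
  by move=> y By; have := rkS y By; rewrite r1 addn1 => -[].
have r2 : r = 2%N by case: r r0 r1 r3 r_le3 {rkS rkU} => [|[|[|[|?]]]].
exists Es, Eu; split=> // y By; split; last by rewrite rkU.
by have := rkS y By; rewrite r2 addn2 => -[].
Qed.
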